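(* Let $\mathbb{X}$ be a complex Banach space. Then the following are equivalent. (i) Every strict contraction $T$ on $\mathbb{X}$ dilates to the unilateral shift $M_z$ on $\ell_2(\mathbb{X})$. (ii) Every strict contraction $T$ on $\mathbb{X}$ dilates to an isometry. (iii) For every strict contraction $T\in\mathcal{B}(\mathbb{X})$, the function $A_T:\mathbb{X}\to[0,\infty)$ given by $A_T(x)=(\|x\|^2-\|Tx\|^2)^{1/2}$, $x\in\mathbb{X}$, defines a norm on $\mathbb{X}$. (iv) $\mathbb{X}$ is a Hilbert space. (v) For every strict contraction $T\in\mathcal{B}(\mathbb{X})$ there exists an isometry $W:\mathbb{X}\to\ell_2(\mathbb{X})$ such that $\widehat{M}_z W(x)=W(Tx)$ for all $x\in\mathbb{X}$. (vi) For every strict contraction $T\in\mathcal{B}(\mathbb{X})$ and for every automorphism $\phi_\lambda$ of the unit disk $\mathbb{D}$, the operator $\phi_\lambda(T)$ is a contraction. (vii) For every strict contraction $S$ on the dual space $\mathbb{X}^*$, the function $A_S:\mathbb{X}^*\to[0,\infty)$ given by $A_S(x^* )=(\|x^*\|^2-\|S(x^* )\|^2)^{1/2}$, $x^*\in\mathbb{X}^*$, defines a norm on $\mathbb{X}^*$. (viii) $\mathbb{X}$ is reflexive and, for every strict contraction $T$ on $\mathbb{X}$, the Banach adjoint $T^\times$ of $T$ dilates to $M_z$ on $\ell_2(\mathbb{X}^* )$. (ix) The operator $\phi_\alpha(U)=(U-\alpha I)(I-\bar\alpha U)^{-1}$ is a contraction for every automorphism $\phi_\alpha$ of $\mathbb{D}$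 (i.e. for every $\alpha\in\mathbb{D}$), where $U$ is the bilateral shift operator on $\ell_2(\mathbb{Z},\mathbb{X})$ defined by $U((x_n)_{n\in\mathbb{Z}})=(x_{n-1})_{n\in\mathbb{Z}}$.
   Context: All spaces are complex. ''Operator'' means bounded linear operator; $T$ is a contraction (strict contraction) if $\|T\|\le 1$ ($\|T\|<1$). An isometry is a linear norm-preserving map (not necessarily onto). A Banach space ''is a Hilbert space'' if its norm is induced by an inner product. The Banach adjoint of $T$ is $T^\times:\mathbb{X}^*\to\mathbb{X}^*$, $T^\times f=f\circ T$. For a Banach space $\mathbb{Y}$, $\ell_2(\mathbb{Y})$ is the space of sequences $(y_n)$ in $\mathbb{Y}$ with $\sum\|y_n\|^2<\infty$, normed by $(\sum\|y_n\|^2)^{1/2}$; $\ell_2(\mathbb{Z},\mathbb{Y})$ is the analogous space of bi-sequences indexed by $\mathbb{Z}$. On $\ell_2(\mathbb{Y})$, $M_z(y_1,y_2,\dots)=(\mathbf 0,y_1,y_2,\dots)$ (forward/unilateral shift) and $\widehat{M}_z(y_1,y_2,y_3,\dots)=(y_2,y_3,\dots)$ (backward shift). Automorphisms of $\mathbb{D}=\{|z|<1\}$ have the form $\phi_\lambda(z)=e^{i\theta}\frac{z-\lambda}{1-\bar\lambda z}$, $\lambda\in\mathbb{D}$, $\theta\in[0,2\pi)$, and $\phi_\lambda(T)=e^{i\theta}(T-\lambda I)(I-\bar\lambda T)^{-1}$. Isometric dilation. Let $T$ be a contraction on a Banach space $\mathbb{X}$. An isometry $V$ on a Banach space $\widetilde{\mathbb{X}}$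 is an isometric dilation of $T$ (one says $T$ dilates to $V$) if there are a linear isometry $W:\mathbb{X}\to\widetilde{\mathbb{X}}$ and a closed linear subspace $\mathbb{L}\subseteq\widetilde{\mathbb{X}}$ such that $\widetilde{\mathbb{X}}=W(\mathbb{X})\oplus_2\mathbb{L}$ (every $u\in\widetilde{\mathbb{X}}$ is uniquely $u=w+l$ with $w\in W(\mathbb{X})$, $l\in\mathbb{L}$, and $\|u\|^2=\|w\|^2+\|l\|^2$) and, with $\widehat{W}:=W:\mathbb{X}\to W(\mathbb{X})$ and $\widehat{T}:=\widehat{W}T\widehat{W}^{-1}$ on $W(\mathbb{X})$, one has $q(\widehat{T})=P_{W(\mathbb{X})}\,q(V)|_{W(\mathbb{X})}$ for all polynomials $q\in\mathbb{C}[z]$, where $P_{W(\mathbb{X})}(w+l)=w$ is the norm-one projection of $\widetilde{\mathbb{X}}$ onto $W(\mathbb{X})$. *)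

(* Defs.v *)
From HB Require Import structures.
From mathcomp Require Import all_boot all_order all_algebra.
From mathcomp Require Import complex finmap.
From mathcomp Require Import all_classical all_reals.
From mathcomp Require Import ring lra.
From mathcomp Require Import ereal topology normedtype sequences esum trigo.

Set Implicit Arguments.
Unset Strict Implicit.
Unset Printing Implicit Defensive.

Import Order.TTheory GRing.Theory Num.Theory.
Import numFieldNormedType.Exports.

Local Open Scope classical_set_scope.
Local Open Scope complex_scope.
Local Open Scope ring_scope.

(* A complex Banach space is a [completeNormedModType R[i]]. There `|x| is a
   nonnegative real element of R[i]; [nrm x] is the same number in [R].
   Likewise the modulus of [a : R[i]], as an element of [R], is
   [complex.Re `|a|]. *)
Section real_valued_norm.
Context {R : realType} {V : normedModType R[i]}.
Implicit Types x y : V.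

Definition nrm x : R := complex.Re `|x|.

Lemma nrmE x : (nrm x)%:C = `|x|.
Proof. by rewrite /nrm RRe_real ?normr_real. Qed.

Lemma nrm_ge0 x : 0 <= nrm x.
Proof. by rewrite -ler0c nrmE. Qed.

Lemma nrm0 : nrm (0 : V) = 0.
Proof. by rewrite /nrm normr0. Qed.

Lemma nrm0_eq0 x : nrm x = 0 -> x = 0.
Proof. by move=> x0; apply: normr0_eq0; rewrite -nrmE x0. Qed.

Lemma nrmN x : nrm (- x) = nrm x.
Proof. by rewrite /nrm normrN. Qed.

Lemma nrmD x y : nrm (x + y) <= nrm x + nrm y.
Proof. by rewrite -lecR rmorphD/= !nrmE ler_normD. Qed.

Lemma nrmB x y : nrm (x - y) = nrm (y - x).
Proof. by rewrite -nrmN opprB. Qed.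

Lemma nrmZ (a : R[i]) x : nrm (a *: x) = complex.Re `|a| * nrm x.
Proof.
apply: complexI; rewrite rmorphM !nrmE normrZ.
congr (_ * _); apply/esym/RRe_real/normr_real.
Qed.

Lemma nrm_triangle z x y : nrm (x - y) <= nrm (x - z) + nrm (z - y).
Proof.
by apply: le_trans (nrmD _ _); rewrite addrA subrK.
Qed.

Lemma cvg_nrmP (F : set_system V) (y : V) : Filter F ->
  (F --> y) <-> (forall e : R, 0 < e -> F [set x | nrm (y - x) < e]).
Proof.
move=> FF; split.
  move=> /(@cvgrPdist_lt _ _ _ F FF id) Fy e e0.
  have /Fy : 0 < e%:C by rewrite (ltcR 0).
  by apply: filterS => x /=; rewrite -nrmE ltcR.
move=> H; apply/(@cvgrPdist_lt _ _ _ F FF id) => e e0.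
have ee : e = (complex.Re e)%:C by rewrite RRe_real ?gtr0_real.
have /H : 0 < complex.Re e by rewrite -(ltcR 0) -ee.
by apply: filterS => x /=; rewrite ee -nrmE ltcR.
Qed.

Lemma cauchy_nrmP (F : set_system V) : ProperFilter F ->
  cauchy F <-> (forall e : R, 0 < e ->
    exists2 A, F A & forall x y, A x -> A y -> nrm (x - y) < e).
Proof.
move=> FF; split => [/cauchyP Fc e e0|H].
  have /Fc[x Fx] : 0 < (e / 2)%:C by rewrite (ltcR 0) divr_gt0.
  exists (ball x (e / 2)%:C) => // y z.
  rewrite -!ball_normE /= -!nrmE !ltcR => xy xz.
  apply: (le_lt_trans (nrm_triangle x y z)).
  by rewrite (splitr e) ltrD// nrmB.
apply/cauchyP => e e0.
have ee : e = (complex.Re e)%:C by rewrite RRe_real ?gtr0_real.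
have /H[A FA AA] : 0 < complex.Re e by rewrite -(ltcR 0) -ee.
have [x Ax] := @filter_ex _ _ FF _ FA.
exists x; apply: filterS FA => y Ay.
by rewrite -ball_normE /= ee -nrmE ltcR AA.
Qed.

End real_valued_norm.

Lemma Re_norm_ge0 {R : realType} (a : R[i]) : 0 <= complex.Re `|a|.
Proof. by rewrite -ler0c RRe_real ?normr_real. Qed.

Section lipschitz_cauchy.
Context {R : realType} {V W : normedModType R[i]}.

Lemma cauchy_lipschitz (g : V -> W) (M : R) (F : set_system V) :
  ProperFilter F -> (forall x y, nrm (g x - g y) <= M * nrm (x - y)) ->
  cauchy F -> cauchy (g @ F).
Proof.
move=> FF gM /cauchy_nrmP Fc; apply/cauchy_nrmP => e e0.
have M0 : 0 < `|M| + 1 by rewrite ltr_wpDl.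
have /Fc[A FA AA] : 0 < e / (`|M| + 1) by rewrite divr_gt0.
exists (g @` A); first by apply: (@filterS _ F _ A _ _ FA) => x Ax; exists x.
move=> _ _ [x Ax <-] [y Ay <-].
apply: (le_lt_trans (gM _ _)).
have := AA _ _ Ax Ay; rewrite ltr_pdivlMr// mulrC => /(le_lt_trans _); apply.
rewrite ler_wpM2r ?nrm_ge0// (le_trans (ler_norm _))// lerDl//.
Qed.

End lipschitz_cauchy.

Section complex_complete.
Context {R : realType}.

Lemma Re_le_normc (z : R[i]) : `|complex.Re z| <= complex.Re `|z|.
Proof.
case: z => a b; rewrite normc_def /= -sqrtr_sqr ler_sqrt ?addr_ge0 ?sqr_ge0//.
by rewrite lerDl sqr_ge0.
Qed.

Lemma Im_le_normc (z : R[i]) : `|complex.Im z| <= complex.Re `|z|.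
Proof.
case: z => a b; rewrite normc_def /= -sqrtr_sqr ler_sqrt ?addr_ge0 ?sqr_ge0//.
by rewrite lerDr sqr_ge0.
Qed.

Lemma normc_le_ReIm (z : R[i]) : complex.Re `|z| <= `|complex.Re z| + `|complex.Im z|.
Proof.
case: z => a b; rewrite normc_def /=.
rewrite -[leRHS]ger0_norm ?addr_ge0// -sqrtr_sqr ler_sqrt ?sqr_ge0//.
rewrite sqrrD !real_normK ?num_real// -addrA lerD2l lerDr.
by rewrite mulrn_wge0// mulr_ge0.
Qed.

Lemma complex_complete (F : set_system R[i]^o) :
  ProperFilter F -> cauchy F -> cvg F.
Proof.
move=> FF /cauchy_nrmP Fc.
have key (g : R[i]^o -> R) : (forall x y, `|g x - g y| <= nrm (x - y)) ->
    exists l, forall e : R, 0 < e -> F [set x | `|l - g x| < e].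
  move=> gl.
  have : cauchy (g @ F).
    apply/cauchyP => e e0; have [A FA AA] := Fc _ e0.
    have [x Ax] := @filter_ex _ _ FF _ FA.
    exists (g x); apply: (@filterS _ F _ A _ _ FA) => y Ay.
    by rewrite -ball_normE /=; apply: le_lt_trans (AA _ _ Ax Ay).
  move=> /cauchy_cvg /cvg_ex[l gFl]; exists l => e e0.
  by move/cvgrPdist_lt : gFl => /(_ _ e0).
have ReL (x y : R[i]^o) : `|complex.Re x - complex.Re y| <= nrm (x - y).
  by case: x y => [x1 x2] [y1 y2]; exact: (Re_le_normc (x1 +i* x2 - y1 +i* y2)).
have ImL (x y : R[i]^o) : `|complex.Im x - complex.Im y| <= nrm (x - y).
  by case: x y => [x1 x2] [y1 y2]; exact: (Im_le_normc (x1 +i* x2 - y1 +i* y2)).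
have [a aP] := key _ ReL.
have [b bP] := key _ ImL.
apply/cvg_ex; exists (a +i* b : R[i]^o); apply/cvg_nrmP => e e0.
have e20 : 0 < e / 2 by rewrite divr_gt0.
apply: (@filterS _ F _ _ _ _ (filterI (aP _ e20) (bP _ e20))) => x /= [xa xb].
apply: (le_lt_trans (normc_le_ReIm _)).
case: x xa xb => c d /= ac bd.
by rewrite (splitr e) ltrD.
Qed.

HB.instance Definition _ := NormedModule.copy R[i] R[i]^o.
HB.instance Definition _ := Uniform_isComplete.Build R[i] complex_complete.

End complex_complete.

Section bounded_operators.
Context {R : realType} {X Y : normedModType R[i]}.

Definition bounded_linear : {pred X -> Y} :=
  [pred f | `[< linear f /\ exists M : R, forall x, nrm (f x) <= M * nrm x >]].

Lemma bounded_linear_submod_closed : submod_closed bounded_linear.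
Proof.
split.
  apply/asboolP; split; first by move=> a x y /=; rewrite scaler0 addr0.
  by exists 0 => x; rewrite mul0r nrm0.
move=> a f g /asboolP[fl [M fM]] /asboolP[gl [N gN]]; apply/asboolP; split.
  move=> b x y /=; rewrite -[LHS]/(a *: f (b *: x + y) + g (b *: x + y)).
  rewrite -[RHS]/(b *: (a *: f x + g x) + (a *: f y + g y)).
  by rewrite fl gl !scalerDr !scalerA (mulrC a) addrACA.
exists (complex.Re `|a| * M + N) => x; rewrite -[X in nrm X]/(a *: f x + g x).
apply: (le_trans (nrmD _ _)); rewrite nrmZ mulrDl lerD// -mulrA ler_wpM2l//.
exact: Re_norm_ge0.
Qed.

HB.instance Definition _ := GRing.isSubmodClosed.Build R[i] (X -> Y)
  bounded_linear bounded_linear_submod_closed.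

(* The bounded linear operators from X to Y, normed by [opnorm] below. *)
Record bop := Bop { bop_fun :> X -> Y ; bopP : bop_fun \in bounded_linear }.

HB.instance Definition _ := [isSub for bop_fun].
HB.instance Definition _ := [Choice of bop by <:].
HB.instance Definition _ := [SubChoice_isSubLmodule of bop by <:].

Lemma bop_linear (f : bop) : linear f.
Proof. by have /asboolP[] := bopP f. Qed.

HB.instance Definition _ (f : bop) :=
  GRing.isLinear.Build R[i] X Y *:%R f (bop_linear f).

Lemma bop_bounded (f : bop) : exists M : R, forall x, nrm (f x) <= M * nrm x.
Proof. by have /asboolP[] := bopP f. Qed.

Lemma bopext (f g : bop) : f =1 g -> f = g.
Proof. by move=> fg; apply/val_inj/funext. Qed.

Lemma bopDE (f g : bop) x : (f + g) x = f x + g x. Proof. by []. Qed.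

Lemma bopBE (f g : bop) x : (f - g) x = f x - g x. Proof. by []. Qed.

Lemma bopZE (a : R[i]) (f : bop) x : (a *: f) x = a *: f x. Proof. by []. Qed.

Definition opnorm (f : bop) : R :=
  sup [set nrm (f x) | x in [set x | nrm x <= 1]].

Lemma opnorm_has_sup (f : bop) :
  has_sup [set nrm (f x) | x in [set x | nrm x <= 1]].
Proof.
split; first by exists (nrm (f 0)), 0 => //=; rewrite nrm0.
have [M fM] := bop_bounded f.
exists `|M| => _ [x /= x1 <-]; apply: (le_trans (fM x)).
by rewrite (le_trans (ler_wpM2r (nrm_ge0 x) (ler_norm M)))// ler_piMr.
Qed.

Lemma opnorm_ge0 (f : bop) : 0 <= opnorm f.
Proof.
apply: (@le_trans _ _ (nrm (f 0))); first exact: nrm_ge0.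
by apply: ub_le_sup; [case: (opnorm_has_sup f)|exists 0 => //=; rewrite nrm0].
Qed.

Lemma opnormP (f : bop) x : nrm (f x) <= opnorm f * nrm x.
Proof.
have [x0|x0] := eqVneq (nrm x) 0.
  by rewrite (nrm0_eq0 x0) linear0 !nrm0 mulr0.
have xgt0 : 0 < nrm x by rewrite lt0r x0 nrm_ge0.
have nx : complex.Re `|((nrm x)^-1)%:C| = (nrm x)^-1.
  by rewrite ger0_norm// ler0c invr_ge0 nrm_ge0.
rewrite -ler_pdivrMr// mulrC -nx -nrmZ -linearZ.
apply: ub_le_sup; first by case: (opnorm_has_sup f).
by eexists => //=; rewrite nrmZ nx mulVf.
Qed.

Lemma opnorm_le (f : bop) (M : R) : 0 <= M ->
  (forall x, nrm (f x) <= M * nrm x) -> opnorm f <= M.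
Proof.
move=> M0 fM; apply: ge_sup; first by case: (opnorm_has_sup f).
by move=> _ [x /= x1 <-]; rewrite (le_trans (fM x))// ler_piMr.
Qed.

Definition bop_norm (f : bop) : R[i] := (opnorm f)%:C.

Lemma bop_normD f g : bop_norm (f + g) <= bop_norm f + bop_norm g.
Proof.
rewrite /bop_norm -rmorphD lecR; apply: opnorm_le.
  by rewrite addr_ge0 ?opnorm_ge0.
move=> x; rewrite mulrDl; apply: (le_trans (nrmD _ _)).
by rewrite lerD ?opnormP.
Qed.

Lemma bop_normZ (a : R[i]) f : bop_norm (a *: f) = `|a| * bop_norm f.
Proof.
have le_normZ (b : R[i]) g : opnorm (b *: g) <= complex.Re `|b| * opnorm g.
  apply: opnorm_le; first by rewrite mulr_ge0 ?Re_norm_ge0 ?opnorm_ge0.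
  move=> x; rewrite -[X in nrm X]/(b *: g x) nrmZ -mulrA.
  by rewrite ler_wpM2l ?opnormP ?Re_norm_ge0.
have [->|a0] := eqVneq a 0.
  rewrite scale0r normr0 mul0r; congr (_%:C).
  apply/eqP; rewrite eq_le opnorm_ge0 andbT.
  by apply: opnorm_le => // x; rewrite nrm0 mul0r.
have na : `|a| = (complex.Re `|a|)%:C by rewrite RRe_real ?normr_real.
have Ra0 : 0 < complex.Re `|a| by rewrite -(ltcR 0) -na normr_gt0.
rewrite /bop_norm na -rmorphM; congr (_%:C).
apply/eqP; rewrite eq_le le_normZ /=.
have := le_normZ a^-1 (a *: f); rewrite scalerK// normfV.
have -> : complex.Re (`|a|^-1 : R[i]) = (complex.Re `|a|)^-1.
  by rewrite [in LHS]na -fmorphV.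
by rewrite mulrC ler_pdivlMr// mulrC.
Qed.

Lemma bop_norm0_eq0 f : bop_norm f = 0 -> f = 0.
Proof.
move=> [f0]; apply: bopext => x; apply: nrm0_eq0; apply/eqP.
by rewrite eq_le nrm_ge0 andbT (le_trans (opnormP f x))// f0 mul0r.
Qed.

HB.instance Definition _ :=
  Lmodule_isNormed.Build R[i] bop bop_normD bop_normZ bop_norm0_eq0.

Lemma nrm_bop (f : bop) : nrm f = opnorm f.
Proof. by []. Qed.

End bounded_operators.

Arguments bop {R} X Y.

Section bop_complete.
Context {R : realType} {X : normedModType R[i]} {Y : completeNormedModType R[i]}.

Lemma bop_complete (F : set_system (bop X Y)) :
  ProperFilter F -> cauchy F -> cvg F.
Proof.
move=> FF Fc.
have lP (x : X) : exists l : Y, forall e : R, 0 < e ->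
    F [set f | nrm (l - f x) < e].
  have : cauchy ((fun f : bop X Y => f x) @ F).
    apply: (cauchy_lipschitz (M := nrm x)) Fc => f g.
    by rewrite mulrC -bopBE nrm_bop opnormP.
  move=> /cauchy_cvg /cvg_ex[l /cvg_nrmP lF]; exists l => e e0.
  exact: lF.
have [l {}lP] := choice lP.
have small (y : Y) : (forall e : R, 0 < e -> nrm y <= e) -> y = 0.
  move=> H; apply: nrm0_eq0; apply/eqP; rewrite eq_le nrm_ge0 andbT.
  by apply/ler_addgt0Pl => e e0; rewrite addr0 H.
have llin : linear l.
  move=> a x y; apply/eqP; rewrite -subr_eq0; apply/eqP/small => e e0.
  pose b := complex.Re `|a| + 1 : R.
  have b0 : 0 < b by rewrite ltr_wpDl ?Re_norm_ge0.
  have e30 : 0 < e / 3 by rewrite divr_gt0.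
  have eb0 : 0 < e / 3 / b by rewrite divr_gt0.
  have [f /= [f1 [f2 f3]]] := filter_ex
    (filterI (lP (a *: x + y) _ e30) (filterI (lP x _ eb0) (lP y _ e30))).
  have -> : l (a *: x + y) - (a *: l x + l y) =
      (l (a *: x + y) - f (a *: x + y)) - (a *: (l x - f x) + (l y - f y)).
    by rewrite (linearP f) scalerBr (addrACA (a *: l x)) -opprD opprB [RHS]addrA subrK.
  apply: (le_trans (nrmD _ _)); rewrite nrmN.
  have -> : e = e / 3 + (e / 3 + e / 3) by field.
  apply: lerD; first exact: ltW.
  apply: (le_trans (nrmD _ _)); apply: lerD; last exact: ltW.
  rewrite nrmZ; apply: (@le_trans _ _ (b * nrm (l x - f x))).
    by rewrite ler_wpM2r ?nrm_ge0// lerDl.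
  by rewrite mulrC -ler_pdivlMr// ltW.
have close (e : R) (A : set (bop X Y)) : F A ->
    (forall f g, A f -> A g -> nrm (f - g) < e) ->
    forall f x, A f -> nrm (l x - f x) <= e * nrm x.
  move=> FA Ae f x Af; apply/ler_addgt0Pl => d d0.
  have [g /= [Ag gd]] := filter_ex (filterI FA (lP x _ d0)).
  apply: (le_trans (nrm_triangle (g x) _ _)); apply: lerD; first exact: ltW.
  rewrite -bopBE; apply: (le_trans (opnormP _ _)).
  by rewrite ler_wpM2r ?nrm_ge0// ltW// -nrm_bop Ae.
have lbnd : l \in @bounded_linear R X Y.
  apply/asboolP; split=> //.
  have /cauchy_nrmP/(_ _ ltr01)[A FA A1] := Fc.
  have [f Af] := filter_ex FA.
  exists (1 + opnorm f) => x; rewrite -[l x](subrK (f x)) mulrDl.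
  by rewrite (le_trans (nrmD _ _))// lerD ?opnormP ?(close _ A).
apply/cvg_ex; exists (Bop lbnd); apply/cvg_nrmP => e e0.
have e20 : 0 < e / 2 by rewrite divr_gt0.
have /cauchy_nrmP/(_ _ e20)[A FA Ae] := Fc.
apply: (@filterS _ F _ A _ _ FA) => f Af /=.
apply: (@le_lt_trans _ _ (e / 2)); last by rewrite ltr_pdivrMr// ltr_pMr// ltr1n.
by rewrite nrm_bop opnorm_le// ?ltW// => x; apply: (close _ A).
Qed.

HB.instance Definition _ := Uniform_isComplete.Build (bop X Y) bop_complete.

End bop_complete.

Section composition.
Context {R : realType} {X Y Z : normedModType R[i]}.

Lemma bounded_linear_id : (idfun : X -> X) \in @bounded_linear R X X.
Proof.
by apply/asboolP; split=> //; exists 1 => x; rewrite mul1r.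
Qed.

Definition bop_id : bop X X := Bop bounded_linear_id.

Lemma bounded_linear_comp (g : bop Y Z) (f : bop X Y) :
  g \o f \in @bounded_linear R X Z.
Proof.
apply/asboolP; split; first by move=> a x y /=; rewrite !linearP.
exists (opnorm g * opnorm f) => x; rewrite -mulrA.
by rewrite (le_trans (opnormP _ _))// ler_wpM2l ?opnorm_ge0 ?opnormP.
Qed.

Definition bop_comp (g : bop Y Z) (f : bop X Y) : bop X Z :=
  Bop (bounded_linear_comp g f).

Lemma opnorm_comp g f : opnorm (bop_comp g f) <= opnorm g * opnorm f.
Proof.
apply: opnorm_le => [|x /=]; first by rewrite mulr_ge0 ?opnorm_ge0.
by rewrite -mulrA (le_trans (opnormP _ _))// ler_wpM2l ?opnorm_ge0 ?opnormP.
Qed.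

End composition.

Section inverse.
Context {R : realType} {X : completeNormedModType R[i]}.
Implicit Types A B : bop X X.

Definition bop_is_inverse A B :=
  bop_comp A B = bop_id /\ bop_comp B A = bop_id.

(* The inverse of an invertible operator (and 0 otherwise). *)
Definition bop_inv A : bop X X := xget 0 [set B | bop_is_inverse A B].

Lemma bop_is_inverse_inj A B C :
  bop_is_inverse A B -> bop_is_inverse A C -> B = C.
Proof.
move=> [_ BA] [AC _]; apply: bopext => x.
have := congr1 (fun f : bop X X => f (C x)) BA => /= <-.
by have /= -> := congr1 (fun f : bop X X => f x) AC.
Qed.

Lemma bop_invP A B : bop_is_inverse A B -> bop_inv A = B.
Proof.
by move=> AB; apply: (@bop_is_inverse_inj A) => //; exact: xgetI AB.
Qed.

Lemma opnorm_id : opnorm (@bop_id R X) <= 1.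
Proof. by apply: opnorm_le => // x; rewrite mul1r. Qed.

Let pow A k : bop X X := iter k (bop_comp A) bop_id.

Let opnorm_pow A k : opnorm (pow A k) <= opnorm A ^+ k.
Proof.
elim: k => [|k IH]; first by rewrite expr0 opnorm_id.
by rewrite exprS (le_trans (opnorm_comp _ _))// ler_wpM2l ?opnorm_ge0.
Qed.

Let S A n : bop X X := \sum_(k < n) pow A k.

Let S_dist A n m : opnorm A < 1 ->
  nrm (S A (n + m) - S A n) <= opnorm A ^+ n / (1 - opnorm A).
Proof.
move=> A1; set r := opnorm A; have r0 : 0 <= r := opnorm_ge0 A.
have r1 : 0 < 1 - r by rewrite subr_gt0.
suff H : nrm (S A (n + m) - S A n) <= (r ^+ n - r ^+ (n + m)) / (1 - r).
  by rewrite (le_trans H)// ler_wpM2r ?invr_ge0 ?(ltW r1)// gerBl exprn_ge0.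
elim: m => [|m IH]; first by rewrite addn0 !subrr mul0r nrm0.
rewrite addnS /S big_ord_recr /= -/(S A (n + m)) addrAC.
apply: (le_trans (nrmD _ _)).
apply: (le_trans (lerD IH (opnorm_pow A _))); rewrite -/r.
by rewrite le_eqVlt; apply/orP; left; apply/eqP; rewrite exprS; field; rewrite gt_eqF.
Qed.

Lemma bop_inv_neumann A : `|A| < 1 ->
  bop_is_inverse (bop_id - A) (bop_inv (bop_id - A)).
Proof.
rewrite -nrmE (ltcR _ 1) nrm_bop => A1.
set r := opnorm A; have r0 : 0 <= r := opnorm_ge0 A.
have r1 : 0 < 1 - r by rewrite subr_gt0.
have small e : 0 < e -> exists N, forall n, (N <= n)%N -> r ^+ n < e.
  move=> e0; have /cvgrPdist_lt/(_ _ e0)[N _ NP] := cvg_expr (eq_ind_r (fun t => t < 1) A1 (ger0_norm r0)).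
  exists N => n Nn; have := NP n Nn; rewrite /= sub0r normrN ger0_norm//.
  by rewrite exprn_ge0.
have : cauchy (S A @ \oo).
  apply/cauchy_nrmP => e e0.
  have [N NP] := small (e / 2 * (1 - r)) ltac:(by rewrite mulr_gt0// divr_gt0).
  have NS n : (N <= n)%N -> nrm (S A n - S A N) < e / 2.
    move=> /subnKC <-; apply: (le_lt_trans (S_dist _ _ A1)).
    by rewrite ltr_pdivrMr// NP.
  exists [set S A n | n in [set n | (N <= n)%N]].
    by exists N => // n Nn; exists n.
  move=> _ _ [n Nn <-] [m Nm <-].
  apply: (le_lt_trans (nrm_triangle (S A N) _ _)).
  by rewrite (splitr e) ltrD ?NS// nrmB NS.
move=> /cauchy_cvg /cvg_ex[L /cvg_nrmP LP].
have SL e : 0 < e -> exists N, forall n, (N <= n)%N -> nrm (L - S A n) < e.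
  by move=> /LP[N _ NP]; exists N => n; exact: NP.
have eq0 (B : bop X X) : (forall e : R, 0 < e -> nrm B <= e) -> B = 0.
  move=> H; apply: nrm0_eq0; apply/eqP; rewrite eq_le nrm_ge0 andbT.
  by apply/ler_addgt0Pl => e e0; rewrite addr0 H.
have compBr (f g h : bop X X) :
    bop_comp f (g - h) = bop_comp f g - bop_comp f h.
  by apply: bopext => x /=; rewrite linearB.
have compDr (f g h : bop X X) :
    bop_comp f (g + h) = bop_comp f g + bop_comp f h.
  by apply: bopext => x /=; rewrite linearD.
have powSr k : bop_comp (pow A k) A = pow A k.+1.
  by elim: k => [|k IH]; apply: bopext => x //=;
    move: (congr1 (fun f : bop X X => f x) IH) => /= ->.
have SS n : S A n.+1 = S A n + pow A n by rewrite /S big_ord_recr.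
have S0 : S A 0 = 0 by rewrite /S big_ord0.
have Sr n : bop_comp A (S A n) = S A n.+1 - bop_id.
  elim: n => [|n IH].
    by rewrite SS S0 add0r subrr; apply: bopext => x /=; rewrite linear0.
  by rewrite SS compDr IH (SS n.+1) addrAC.
have Sl n : bop_comp (S A n) A = S A n.+1 - bop_id.
  elim: n => [|n IH]; first by rewrite SS S0 add0r subrr; exact: bopext.
  rewrite (SS n.+1) addrAC -IH -powSr.
  by apply: bopext => x; rewrite [in LHS]SS.
have half (e x y : R) : x < e / 2 -> y < e / 2 -> x + y <= e.
  by move=> xe ye; rewrite (splitr e) ltW// ltrD.
have le1 (f : bop X X) : opnorm A * opnorm f <= opnorm f.
  by rewrite ler_piMl ?opnorm_ge0// ltW.
suff H : bop_is_inverse (bop_id - A) L by rewrite (bop_invP H).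
have AL : bop_comp A L = L - bop_id.
  apply/eqP; rewrite -subr_eq0; apply/eqP/eq0 => e e0.
  have [N NP] := SL (e / 2) ltac:(by rewrite divr_gt0).
  have -> : bop_comp A L - (L - bop_id) =
      bop_comp A (L - S A N) - (L - S A N.+1).
    rewrite compBr Sr -[RHS]addrA -opprD; congr (_ - _).
    by rewrite [RHS]addrC addrA subrK.
  apply: (le_trans (nrmD _ _)); rewrite nrmN; apply: half.
    by apply: (le_lt_trans (opnorm_comp _ _)); rewrite (le_lt_trans (le1 _))// NP.
  by rewrite NP// ltnW.
have LA : bop_comp L A = L - bop_id.
  apply/eqP; rewrite -subr_eq0; apply/eqP/eq0 => e e0.
  have [N NP] := SL (e / 2) ltac:(by rewrite divr_gt0).
  have -> : bop_comp L A - (L - bop_id) =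
      bop_comp (L - S A N) A - (L - S A N.+1).
    have -> : bop_comp (L - S A N) A = bop_comp L A - bop_comp (S A N) A.
      exact: bopext.
    rewrite Sl -[RHS]addrA -opprD; congr (_ - _).
    by rewrite [RHS]addrC addrA subrK.
  apply: (le_trans (nrmD _ _)); rewrite nrmN; apply: half.
    apply: (le_lt_trans (opnorm_comp _ _)).
    by rewrite mulrC (le_lt_trans (le1 _))// NP.
  by rewrite NP// ltnW.
split.
  have -> : bop_comp (bop_id - A) L = L - bop_comp A L by exact: bopext.
  by rewrite AL opprB addrC subrK.
rewrite compBr LA.
have -> : bop_comp L bop_id = L by exact: bopext.
by rewrite opprB addrC subrK.
Qed.

End inverse.

Section ell2.
Context {R : realType} {I : choiceType} {Y : normedModType R[i]}.

(* An unordered sum, in the extended reals, over the index type I. *)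
Definition sqsum (y : I -> Y) : \bar R :=
  (\esum_(i in [set: I]) ((nrm (y i)) ^+ 2)%:E)%E.

Lemma sqsum_ge0 y : (0 <= sqsum y)%E.
Proof. by apply: esum_ge0 => i _; rewrite lee_fin sqr_ge0. Qed.

Lemma sqsum_le y (M : R) :
  (forall s, uniq s -> \sum_(i <- s) nrm (y i) ^+ 2 <= M) ->
  (sqsum y <= M%:E)%E.
Proof.
move=> H; apply: ge_ereal_sup => _ [A [finA _] <-].
by rewrite fsbig_finite//= sumEFin lee_fin H.
Qed.

Lemma le_sqsum y s : uniq s ->
  ((\sum_(i <- s) nrm (y i) ^+ 2)%:E <= sqsum y)%E.
Proof.
move=> us; apply: esum_ge; exists [set` s]; first by split.
by rewrite -sumEFin fsbig_seq.
Qed.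

Definition square_summable : {pred I -> Y} := [pred y | (sqsum y < +oo)%E].

Definition l2norm (y : I -> Y) : R := Num.sqrt (fine (sqsum y)).

Lemma l2norm_ge0 y : 0 <= l2norm y.
Proof. exact: sqrtr_ge0. Qed.

Lemma l2norm_ge y s : y \in square_summable -> uniq s ->
  \sum_(i <- s) nrm (y i) ^+ 2 <= l2norm y ^+ 2.
Proof.
rewrite inE => yfin us; rewrite sqr_sqrtr ?fine_ge0 ?sqsum_ge0//.
by rewrite -lee_fin fineK ?le_sqsum// ge0_fin_numE ?sqsum_ge0.
Qed.

Lemma l2norm_le y (M : R) : 0 <= M ->
  (forall s, uniq s -> \sum_(i <- s) nrm (y i) ^+ 2 <= M ^+ 2) ->
  y \in square_summable /\ l2norm y <= M.
Proof.
move=> M0 /sqsum_le yM.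
have yfin : (sqsum y < +oo)%E by rewrite (le_lt_trans yM) ?ltry.
split; first by rewrite inE.
rewrite -[M]ger0_norm// -sqrtr_sqr ler_sqrt ?sqr_ge0//.
by rewrite -lee_fin fineK// ge0_fin_numE ?sqsum_ge0.
Qed.

Lemma nrm_le_l2norm y i : y \in square_summable -> nrm (y i) <= l2norm y.
Proof.
move=> yfin; have := @l2norm_ge y [:: i] yfin isT.
by rewrite big_seq1 ler_sqr ?nnegrE ?nrm_ge0 ?l2norm_ge0.
Qed.

Lemma sum_sqD (s : seq I) (a b : I -> R) (A B : R) : 0 < A -> 0 < B ->
  \sum_(i <- s) a i ^+ 2 <= A ^+ 2 -> \sum_(i <- s) b i ^+ 2 <= B ^+ 2 ->
  \sum_(i <- s) (a i + b i) ^+ 2 <= (A + B) ^+ 2.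
Proof.
move=> A0 B0 aA bB.
have An0 : A != 0 by rewrite gt_eqF.
have Bn0 : B != 0 by rewrite gt_eqF.
apply: (@le_trans _ _ (\sum_(i <- s)
    ((1 + B / A) * a i ^+ 2 + (1 + A / B) * b i ^+ 2))).
  apply: ler_sum => i _; rewrite -subr_ge0.
  have -> : (1 + B / A) * a i ^+ 2 + (1 + A / B) * b i ^+ 2 - (a i + b i) ^+ 2 =
      (B * a i - A * b i) ^+ 2 / (A * B) by field; rewrite ?An0 ?Bn0.
  by rewrite divr_ge0 ?sqr_ge0// mulr_ge0 ?ltW.
rewrite big_split/= -!mulr_sumr.
have -> : (A + B) ^+ 2 = (1 + B / A) * A ^+ 2 + (1 + A / B) * B ^+ 2.
  by field; rewrite ?An0 ?Bn0.
by apply: lerD; rewrite ler_wpM2l// addr_ge0// divr_ge0 ?ltW.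
Qed.

Lemma l2normD y z : y \in square_summable -> z \in square_summable ->
  y + z \in square_summable /\ l2norm (y + z) <= l2norm y + l2norm z.
Proof.
move=> yfin zfin.
apply: l2norm_le => [|s us]; first by rewrite addr_ge0 ?l2norm_ge0.
apply: (@le_trans _ _ (\sum_(i <- s) (nrm (y i) + nrm (z i)) ^+ 2)).
  by apply: ler_sum => i _; rewrite ler_sqr ?nnegrE ?addr_ge0 ?nrm_ge0//; exact: nrmD.
set t := \sum_(i <- s) _.
have t0 : 0 <= t by apply: sumr_ge0 => i _; rewrite sqr_ge0.
rewrite -(sqr_sqrtr t0) ler_sqr ?nnegrE ?sqrtr_ge0 ?addr_ge0 ?l2norm_ge0//.
apply/ler_addgt0Pl => e e0.
have e20 : 0 < e / 2 by rewrite divr_gt0.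
have -> : e + (l2norm y + l2norm z) =
    (l2norm y + e / 2) + (l2norm z + e / 2) by field.
have y0 : 0 < l2norm y + e / 2 by rewrite ltr_wpDl ?l2norm_ge0.
have z0 : 0 < l2norm z + e / 2 by rewrite ltr_wpDl ?l2norm_ge0.
have p0 := addr_ge0 (ltW y0) (ltW z0).
rewrite -(ger0_norm p0) -sqrtr_sqr ler_sqrt ?sqr_ge0//; apply: sum_sqD => //.
  apply: (le_trans (l2norm_ge yfin us)).
  by rewrite ler_sqr ?nnegrE ?l2norm_ge0 ?(ltW y0)// lerDl ltW.
apply: (le_trans (l2norm_ge zfin us)).
by rewrite ler_sqr ?nnegrE ?l2norm_ge0 ?(ltW z0)// lerDl ltW.
Qed.

Lemma l2normZ_le (a : R[i]) y : y \in square_summable ->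
  a *: y \in square_summable /\ l2norm (a *: y) <= complex.Re `|a| * l2norm y.
Proof.
move=> yfin; apply: l2norm_le => [|s us].
  by rewrite mulr_ge0 ?Re_norm_ge0 ?l2norm_ge0.
under eq_bigr do rewrite -[X in nrm X]/(a *: y _) nrmZ exprMn.
by rewrite -mulr_sumr exprMn ler_wpM2l ?sqr_ge0// l2norm_ge.
Qed.

Lemma square_summable0 : 0 \in square_summable.
Proof.
apply: (proj1 (@l2norm_le 0 0 _ _)) => // s _.
by rewrite big1// => i _; rewrite nrm0 expr0n.
Qed.

Lemma square_summable_submod_closed : submod_closed square_summable.
Proof.
split=> [|a y z yfin zfin]; first exact: square_summable0.
by apply: (l2normD _ zfin).1; exact: (l2normZ_le a yfin).1.
Qed.

HB.instance Definition _ := GRing.isSubmodClosed.Build R[i] (I -> Y)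
  square_summable square_summable_submod_closed.

(* [ell2 nat Y] is l_2(Y), with sequences indexed from 0, and [ell2 int Y] is
   l_2(Z, Y); both are normed by [l2norm]. *)
Record ell2 := Ell2 { ell2_fun :> I -> Y; ell2P : ell2_fun \in square_summable }.

HB.instance Definition _ := [isSub for ell2_fun].
HB.instance Definition _ := [Choice of ell2 by <:].
HB.instance Definition _ := [SubChoice_isSubLmodule of ell2 by <:].

Lemma ell2ext (y z : ell2) : y =1 z -> y = z.
Proof. by move=> yz; apply/val_inj/funext. Qed.

Lemma ell2DE (y z : ell2) i : (y + z) i = y i + z i. Proof. by []. Qed.

Lemma ell2BE (y z : ell2) i : (y - z) i = y i - z i. Proof. by []. Qed.

Lemma ell2ZE (a : R[i]) (y : ell2) i : (a *: y) i = a *: y i. Proof. by []. Qed.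

Definition ell2_norm (y : ell2) : R[i] := (l2norm y)%:C.

Lemma ell2_normD y z : ell2_norm (y + z) <= ell2_norm y + ell2_norm z.
Proof.
rewrite /ell2_norm -rmorphD lecR.
exact: (l2normD (ell2P y) (ell2P z)).2.
Qed.

Lemma ell2_norm0_eq0 y : ell2_norm y = 0 -> y = 0.
Proof.
move=> [y0]; apply: ell2ext => i; apply: nrm0_eq0; apply/eqP.
by rewrite eq_le nrm_ge0 andbT -y0 nrm_le_l2norm ?ell2P.
Qed.

Lemma ell2_normZ (a : R[i]) y : ell2_norm (a *: y) = `|a| * ell2_norm y.
Proof.
have [->|a0] := eqVneq a 0.
  rewrite scale0r normr0 mul0r; congr (_%:C).
  apply/eqP; rewrite eq_le l2norm_ge0 andbT.
  apply: (proj2 (@l2norm_le 0 0 _ _)) => // s _.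
  by rewrite big1// => i _; rewrite nrm0 expr0n.
have na : `|a| = (complex.Re `|a|)%:C by rewrite RRe_real ?normr_real.
have Ra0 : 0 < complex.Re `|a| by rewrite -(ltcR 0) -na normr_gt0.
rewrite /ell2_norm na -rmorphM; congr (_%:C).
apply/eqP; rewrite eq_le (l2normZ_le a (ell2P y)).2 /=.
have := (l2normZ_le a^-1 (ell2P (a *: y))).2.
rewrite -[_ *: _]/(ell2_fun (a^-1 *: (a *: y))) scalerK// normfV.
have -> : complex.Re (`|a|^-1 : R[i]) = (complex.Re `|a|)^-1.
  by rewrite [in LHS]na -fmorphV.
by rewrite mulrC ler_pdivlMr// mulrC.
Qed.

HB.instance Definition _ :=
  Lmodule_isNormed.Build R[i] ell2 ell2_normD ell2_normZ ell2_norm0_eq0.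

Lemma nrm_ell2 (y : ell2) : nrm y = l2norm y.
Proof. by []. Qed.

End ell2.

Arguments ell2 {R} I Y.

Section ell2_complete.
Context {R : realType} {I : choiceType} {Y : completeNormedModType R[i]}.

Lemma ell2_complete (F : set_system (ell2 I Y)) :
  ProperFilter F -> cauchy F -> cvg F.
Proof.
move=> FF Fc.
have lP (i : I) : exists l : Y, forall e : R, 0 < e ->
    F [set y | nrm (l - y i) < e].
  have : cauchy ((fun y : ell2 I Y => y i) @ F).
    apply: (cauchy_lipschitz (M := 1)) Fc => y z.
    by rewrite mul1r -ell2BE nrm_le_l2norm ?ell2P.
  move=> /cauchy_cvg /cvg_ex[l /cvg_nrmP lF]; exists l => e e0.
  exact: lF.
have [l {}lP] := choice lP.
have lsP (s : seq I) (e : R) : 0 < e ->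
    F [set y | forall i, i \in s -> nrm (l i - y i) < e].
  move=> e0; elim: s => [|i s IH].
    by apply: (@filterS _ F _ setT _ _ filterT) => y _ i.
  apply: (@filterS _ F _ _ _ _ (filterI (lP i e e0) IH)) => y /= [yi ys] j.
  by rewrite inE => /orP[/eqP ->|/ys].
have close (e : R) (A : set (ell2 I Y)) : 0 < e -> F A ->
    (forall f g, A f -> A g -> nrm (f - g) < e) ->
    forall f, A f -> (l - (f : I -> Y)) \in square_summable /\
      l2norm (l - (f : I -> Y)) <= e.
  move=> e0 FA Ae f Af; apply: l2norm_le (ltW e0) _ => s us.
  set t := \sum_(i <- s) _.
  have t0 : 0 <= t by apply: sumr_ge0 => i _; rewrite sqr_ge0.
  rewrite -(sqr_sqrtr t0) ler_sqr ?nnegrE ?sqrtr_ge0 ?(ltW e0)//.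
  apply/ler_addgt0Pl => d d0.
  rewrite -(ger0_norm (ltW (addr_gt0 d0 e0))) -sqrtr_sqr ler_sqrt ?sqr_ge0//.
  pose n : R := (size s).+1%:R.
  have n0 : 0 < n by rewrite ltr0n.
  have [g /= [Ag gs]] := filter_ex (filterI FA (lsP s _ (divr_gt0 d0 n0))).
  apply: (@le_trans _ _ (\sum_(i <- s) (nrm (l i - g i) + nrm (g i - f i)) ^+ 2)).
    apply: ler_sum => i _; rewrite ler_sqr ?nnegrE ?addr_ge0 ?nrm_ge0//.
    exact: nrm_triangle.
  apply: sum_sqD => //; last first.
    apply: (le_trans (l2norm_ge (ell2P (g - f)) us)).
    by rewrite ler_sqr ?nnegrE ?l2norm_ge0 ?(ltW e0)// ltW// -nrm_ell2 Ae.
  apply: (@le_trans _ _ (\sum_(i <- s) (d / n) ^+ 2)).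
    rewrite big_seq [leRHS]big_seq; apply: ler_sum => i /gs /ltW.
    by rewrite ler_sqr ?nnegrE ?nrm_ge0 ?divr_ge0 ?(ltW d0) ?(ltW n0).
  rewrite big_const_seq count_predT iter_addr_0 -mulr_natl.
  have -> : d ^+ 2 = n ^+ 2 * (d / n) ^+ 2 by field; rewrite gt_eqF.
  rewrite ler_wpM2r ?sqr_ge0// -natrX ler_nat.
  by rewrite (leq_trans (leqnSn _))// leq_pmulr.
have lss : l \in @square_summable R I Y.
  have /cauchy_nrmP/(_ _ ltr01)[A FA A1] := Fc.
  have [f Af] := filter_ex FA.
  rewrite -[l](subrK (f : I -> Y)).
  by have [] := l2normD (close _ _ ltr01 FA A1 _ Af).1 (ell2P f).
apply/cvg_ex; exists (Ell2 lss); apply/cvg_nrmP => e e0.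
have e20 : 0 < e / 2 by rewrite divr_gt0.
have /cauchy_nrmP/(_ _ e20)[A FA Ae] := Fc.
apply: (@filterS _ F _ A _ _ FA) => f Af /=.
apply: (@le_lt_trans _ _ (e / 2)); last by rewrite ltr_pdivrMr// ltr_pMr// ltr1n.
exact: (close _ _ e20 FA Ae _ Af).2.
Qed.

HB.instance Definition _ := Uniform_isComplete.Build (ell2 I Y) ell2_complete.

End ell2_complete.

Section reindexing.
Context {R : realType} {I J : choiceType} {Y : normedModType R[i]}.

Lemma l2norm_reindex (h : I -> option J) (g : J -> I) (y : J -> Y) :
  ocancel h g -> y \in square_summable ->
  (fun i => oapp y 0 (h i)) \in square_summable /\
  l2norm (fun i => oapp y 0 (h i)) <= l2norm y.
Proof.
move=> hg yfin; apply: l2norm_le => [|s us]; first exact: l2norm_ge0.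
have -> : \sum_(i <- s) nrm (oapp y 0 (h i)) ^+ 2 =
    \sum_(j <- pmap h s) nrm (y j) ^+ 2.
  elim: s {us} => [|i s IH]; first by rewrite !big_nil.
  rewrite big_cons IH /=; case: (h i) => [j|] /=; first by rewrite big_cons.
  by rewrite nrm0 expr0n add0r.
by apply: l2norm_ge => //; exact: (pmap_uniq hg).
Qed.

End reindexing.

Section shifts.
Context {R : realType} {Y : normedModType R[i]}.

Definition unilateral_shift_fun (y : nat -> Y) (n : nat) : Y :=
  if n is m.+1 then y m else 0.

Lemma unilateral_shift_fun_ell2 (y : ell2 nat Y) : unilateral_shift_fun y \in square_summable.
Proof.
pose h n := if n is m.+1 then Some m else None.
have hg : ocancel h S by case.
have -> : unilateral_shift_fun y = fun n => oapp y 0 (h n) by apply/funext; case.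
exact: (l2norm_reindex hg (ell2P y)).1.
Qed.

Definition unilateral_shift (y : ell2 nat Y) : ell2 nat Y := Ell2 (unilateral_shift_fun_ell2 y).

Lemma unilateral_shift_linear : linear unilateral_shift.
Proof.
move=> a y z; apply: ell2ext => -[|n]; last by [].
by rewrite -[RHS]/(a *: 0 + 0) scaler0 addr0.
Qed.

HB.instance Definition _ :=
  GRing.isLinear.Build R[i] (ell2 nat Y) (ell2 nat Y) *:%R unilateral_shift unilateral_shift_linear.

Lemma backward_shift_ell2 (y : ell2 nat Y) :
  (fun n => y n.+1) \in square_summable.
Proof.
have hg : ocancel (Some \o S) predn by [].
exact: (l2norm_reindex hg (ell2P y)).1.
Qed.

Definition backward_shift (y : ell2 nat Y) : ell2 nat Y :=
  Ell2 (backward_shift_ell2 y).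

Lemma bilateral_shift_ell2 (y : ell2 int Y) :
  (fun n : int => y (n - 1)) \in square_summable.
Proof.
have hg : ocancel (fun n : int => Some (n - 1)) (fun n => n + 1).
  by move=> n /=; rewrite subrK.
exact: (l2norm_reindex hg (ell2P y)).1.
Qed.

Definition bilateral_shift_fun (y : ell2 int Y) : ell2 int Y := Ell2 (bilateral_shift_ell2 y).

Lemma bilateral_shift_bounded : bilateral_shift_fun \in @bounded_linear R (ell2 int Y) (ell2 int Y).
Proof.
apply/asboolP; split; first by move=> a y z; exact: ell2ext.
exists 1 => y; rewrite mul1r.
have hg : ocancel (fun n : int => Some (n - 1)) (fun n => n + 1).
  by move=> n /=; rewrite subrK.
exact: (l2norm_reindex hg (ell2P y)).2.
Qed.

Definition bilateral_shift : bop (ell2 int Y) (ell2 int Y) := Bop bilateral_shift_bounded.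

End shifts.

Definition banach_dual {R : realType} (X : normedModType R[i]) :
  completeNormedModType R[i] := bop X R[i].

Section duality.
Context {R : realType} {X : normedModType R[i]}.

Lemma adjoint_bounded (T : bop X X) :
  (fun f : banach_dual X => bop_comp f T)
    \in @bounded_linear R (banach_dual X) (banach_dual X).
Proof.
apply/asboolP; split; first by move=> a f g; exact: bopext.
by exists (opnorm T) => f; rewrite mulrC !nrm_bop opnorm_comp.
Qed.

Definition adjoint (T : bop X X) : bop (banach_dual X) (banach_dual X) :=
  Bop (adjoint_bounded T).

Lemma bidual_embed_bounded (x : X) :
  (fun f : banach_dual X => f x) \in @bounded_linear R (banach_dual X) R[i].
Proof.
apply/asboolP; split; first by [].
by exists (nrm x) => f; rewrite mulrC opnormP.
Qed.

Definition bidual_embed (x : X) : banach_dual (banach_dual X) :=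
  Bop (bidual_embed_bounded x).

End duality.

Definition reflexive_space {R : realType} (X : normedModType R[i]) : Prop :=
  forall Phi : banach_dual (banach_dual X), exists x : X, bidual_embed x = Phi.

Section operators.
Context {R : realType} {X : completeNormedModType R[i]}.
Implicit Types (T : bop X X) (a : R[i]).

Definition contractive T : Prop := `|T| <= 1.

Definition strictly_contractive T : Prop := `|T| < 1.

(* (T - a I)(I - a^* T)^-1; the inverse exists whenever `|a| < 1 and T is
   contractive, see [one_sub_scale_invertible]. *)
Definition blaschke a T : bop X X :=
  bop_comp (T - a *: bop_id) (bop_inv (bop_id - a^* *: T)).

Definition disk_automorphism (theta : R) a T : bop X X :=
  (cos theta +i* sin theta) *: blaschke a T.

Lemma one_sub_scale_invertible a T : `|a| < 1 -> contractive T ->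
  bop_is_inverse (bop_id - a^* *: T) (bop_inv (bop_id - a^* *: T)).
Proof.
move=> a1 T1; apply: bop_inv_neumann; rewrite normrZ.
have -> : `|a^* : R[i]| = `|a| by exact: norm_conjC.
by rewrite (le_lt_trans _ a1)// ler_piMr.
Qed.

(* The radicand is nonnegative when T is contractive. *)
Definition defect T (x : X) : R := Num.sqrt (nrm x ^+ 2 - nrm (T x) ^+ 2).

Definition is_norm (N : X -> R) : Prop :=
  [/\ forall x, 0 <= N x,
      forall x, N x = 0 -> x = 0,
      forall a x, N (a *: x) = complex.Re `|a| * N x
    & forall x y, N (x + y) <= N x + N y].

End operators.

(* A [{dot X for Num.conj}] is a positive definite sesquilinear Hermitian form,
   linear in its first argument. *)
Definition is_hilbert {R : realType} (X : completeNormedModType R[i]) : Prop :=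
  exists ip : {dot X for Num.conj}, forall x : X, `|x| ^+ 2 = ip x x.

Section dilation.
Context {R : realType}.

Definition linear_isometry {X Y : normedModType R[i]} (W : {linear X -> Y}) :=
  forall x, `|W x| = `|x|.

Definition direct_sum2 {V : normedModType R[i]} (A L : set V) : Prop :=
  (forall u, exists! p : V * V, [/\ A p.1, L p.2 & u = p.1 + p.2]) /\
  (forall w l, A w -> L l -> `|w + l| ^+ 2 = `|w| ^+ 2 + `|l| ^+ 2).

(* The component in A of u, when V is the direct sum of A and L. *)
Definition proj_along {V : normedModType R[i]} (A L : set V) (u : V) : V :=
  xget 0 [set w | A w /\ L (u - w)].

Lemma proj_alongE {V : normedModType R[i]} (A L : set V) (w l : V) :
  direct_sum2 A L -> A w -> L l -> proj_along A L (w + l) = w.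
Proof.
move=> [uniq_dec _] Aw Ll; rewrite /proj_along.
apply: xget_unique => [|w' [Aw' Ll']]; first by split=> //; rewrite (addrC w) addrK.
have [p [_ pU]] := uniq_dec (w + l).
have E1 := pU (w, l) (And3 Aw Ll erefl).
have E2 := pU (w', w + l - w') (And3 Aw' Ll' (esym (subrKC w' (w + l)))).
by have [] := etrans (esym E2) E1.
Qed.

Definition poly_map {V : lmodType R[i]} (q : {poly R[i]}) (A : V -> V) (v : V)
  : V := \sum_(k < size q) q`_k *: iter k A v.

(* W T W^-1, meaningful on the range of the injective map W only. *)
Definition transport {X V : normedModType R[i]} (W : X -> V) (T : X -> X)
  (w : V) : V := W (T (xget 0 [set x | W x = w])).

Lemma transportE {X V : normedModType R[i]} (W : {linear X -> V}) T x :
  linear_isometry W -> transport W T (W x) = W (T x).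
Proof.
move=> iW; rewrite /transport; congr (W (T _)); apply: xget_unique => // y Wy.
by apply/eqP; rewrite -subr_eq0 -normr_eq0 -iW linearB Wy subrr normr0.
Qed.

Definition isometric_dilation {X Xt : completeNormedModType R[i]}
    (T : bop X X) (V : {linear Xt -> Xt}) : Prop :=
  linear_isometry V /\
  exists (W : {linear X -> Xt}) (L : set Xt),
    [/\ linear_isometry W,
        closed L /\ submod_closed [in L],
        direct_sum2 (range W) L
      & forall (q : {poly R[i]}) (w : Xt), range W w ->
          poly_map q (transport W T) w =
          proj_along (range W) L (poly_map q V w)].

End dilation.

(* Main.v *)
(* A Banach space is a Hilbert space iff it satisfies the parallelogram law (PL).
   Under PL, Re<x, y> = (|x + y|^2 - |x - y|^2) / 4, Riesz representation yields
   adjoints, and I - T^* T has a square root J; then W x = (J T^n x)_n intertwines T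
   with the backward shift, and the W built from T^* turns M_z into a dilation of T.
   PL passes to l_2 sums and to duals, and makes (T - a I)(I - a^* T)^-1 contractive
   because |y - a^* T y|^2 - |T y - a y|^2 = (1 - |a|^2)(|y|^2 - |T y|^2).
   Conversely, a dilation makes the defect of T a norm. Defects of rank one operators
   tending to x |-> f(x) x0, with f(x0) = |f| = |x0| = 1, show that ker f and x0 span
   an l_2 sum, whence PL. The conditions on disk automorphisms give
   |x - t y| = |y - t x| for unit vectors x, y, which is Ficken's criterion: exchanging
   two unit vectors of a real plane is an isometry, and the trace of a product of three
   such exchanges must vanish, which determines the norm of the plane. *)

From HB Require Import structures.
Require Import Defs.
From mathcomp Require Import all_boot all_order all_algebra.
From mathcomp Require Import complex.
From mathcomp Require Import all_classical all_reals.
From mathcomp Require Import ereal topology normedtype sequences esum trigo.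
From mathcomp Require Import ring lra.

Set Implicit Arguments.
Unset Strict Implicit.
Unset Printing Implicit Defensive.

Import Order.TTheory GRing.Theory Num.Theory.
Import numFieldNormedType.Exports.
Local Open Scope classical_set_scope.
Local Open Scope complex_scope.
Local Open Scope ring_scope.

(** * The parallelogram law and the real inner product *)

Definition parallelogram {R : realType} (V : normedModType R[i]) : Prop :=
  forall x y : V,
    nrm (x + y) ^+ 2 + nrm (x - y) ^+ 2 = 2 * (nrm x ^+ 2 + nrm y ^+ 2).

Section norm.
Context {R : realType} {V : normedModType R[i]}.
Implicit Types x y z : V.

Lemma Re_normC (r : R) : complex.Re `|r%:C| = `|r|.
Proof. by rewrite normc_def /= expr0n /= addr0 sqrtr_sqr. Qed.

Lemma nrmZr (r : R) x : nrm (r%:C *: x) = `|r| * nrm x.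
Proof. by rewrite nrmZ Re_normC. Qed.

Lemma sqr_normc (a : R[i]) :
  complex.Re `|a| ^+ 2 = complex.Re a ^+ 2 + complex.Im a ^+ 2.
Proof. by case: a => s t; rewrite normc_def /= sqr_sqrtr// addr_ge0 ?sqr_ge0. Qed.

Lemma nrm_small0 x : (forall e : R, 0 < e -> nrm x <= e) -> x = 0.
Proof.
move=> H; apply: nrm0_eq0; apply/eqP; rewrite eq_le nrm_ge0 andbT.
by apply/ler_addgt0Pl => e e0; rewrite addr0 H.
Qed.

Lemma scaleRD (r s : R) x : (r + s)%:C *: x = r%:C *: x + s%:C *: x.
Proof. by rewrite rmorphD scalerDl. Qed.

End norm.

Section real_inner_product.
Context {R : realType} {V : normedModType R[i]}.
Implicit Types x y z : V.

(** The real part of the inner product by polarization. The formula makes sense in every normed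
    space; its additivity rests on the parallelogram law. *)
Definition rip x y : R := (nrm (x + y) ^+ 2 - nrm (x - y) ^+ 2) / 4.

Hypothesis PL : parallelogram V.

Lemma ripxx x : rip x x = nrm x ^+ 2.
Proof.
rewrite /rip subrr nrm0 expr0n subr0.
have -> : x + x = 2%:C *: x by rewrite -[2]/(1 + 1) scaleRD !scale1r.
by rewrite nrmZr ger0_norm// exprMn; field.
Qed.

Lemma ripC x y : rip x y = rip y x.
Proof. by rewrite /rip (addrC x) (nrmB x). Qed.

Lemma rip0l y : rip 0 y = 0.
Proof. by rewrite /rip add0r sub0r nrmN subrr mul0r. Qed.

(** Subtract the parallelogram laws of the pairs [x + z], [y + z] and [x - z], [y - z]: the terms in
    [x - y] cancel. *)
Let rip_half x y z : rip x z + rip y z = rip (x + y) (z + z) / 2.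
Proof.
have p1 := PL (x + z) (y + z); have p2 := PL (x - z) (y - z).
have e1 : x + z - (y + z) = x - y by rewrite opprD addrACA subrr addr0.
have e2 : x - z - (y - z) = x - y by rewrite opprB addrCA addrA subrKC.
have e3 : x + z + (y + z) = x + y + (z + z) by rewrite addrACA.
have e4 : x - z + (y - z) = x + y - (z + z) by rewrite addrACA opprD.
by move: p1 p2; rewrite e1 e2 e3 e4 /rip; lra.
Qed.

Lemma ripDl x y z : rip (x + y) z = rip x z + rip y z.
Proof.
(* The pair [x + y], [0] undoes the doubling of [z]. *)
rewrite rip_half; have := rip_half (x + y) 0 z.
by rewrite rip0l !addr0.
Qed.

Lemma ripDr x y z : rip x (y + z) = rip x y + rip x z.
Proof. by rewrite ripC ripDl !(ripC _ x). Qed.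

Lemma ripNl x y : rip (- x) y = - rip x y.
Proof. by apply/eqP; rewrite -addr_eq0 -ripDl addNr rip0l. Qed.

Lemma ripNr x y : rip x (- y) = - rip x y.
Proof. by rewrite ripC ripNl ripC. Qed.

Lemma sqr_nrmD x y : nrm (x + y) ^+ 2 = nrm x ^+ 2 + 2 * rip x y + nrm y ^+ 2.
Proof. by rewrite -!ripxx ripDl !ripDr (ripC y x); ring. Qed.

Lemma sqr_nrmB x y : nrm (x - y) ^+ 2 = nrm x ^+ 2 - 2 * rip x y + nrm y ^+ 2.
Proof. by rewrite sqr_nrmD nrmN ripNr; ring. Qed.

Lemma rip_le x y : rip x y <= nrm x * nrm y.
Proof.
have : nrm (x + y) ^+ 2 <= (nrm x + nrm y) ^+ 2.
  by rewrite ler_sqr ?nnegrE ?addr_ge0 ?nrm_ge0// nrmD.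
by rewrite sqr_nrmD sqrrD mulr2n; lra.
Qed.

Lemma rip_norm_le x y : `|rip x y| <= nrm x * nrm y.
Proof. by rewrite ler_norml rip_le andbT lerNl -ripNl -(nrmN x) rip_le. Qed.

End real_inner_product.

(** For [t >= 0], additivity makes n f(t) - n t f(1) depend only on the fractional part of n t, so
    it is at most 2 C in modulus, while n is arbitrarily large. *)
Lemma additive_linear {R : realType} (f : R -> R) (C : R) :
  {morph f : s t / s + t} -> (forall t, `|f t| <= C * `|t|) ->
  forall t, f t = t * f 1.
Proof.
move=> fD fC.
have f0 : f 0 = 0 by apply: (addrI (f 0)); rewrite -fD !addr0.
have fn (n : nat) s : f (n%:R * s) = n%:R * f s.
  elim: n => [|n IH]; first by rewrite !mul0r f0.
  by rewrite -natr1 !mulrDl !mul1r fD IH.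
have fN s : f (- s) = - f s.
  by apply/eqP; rewrite -addr_eq0 -fD addNr f0.
have C0 : 0 <= C.
  by have := fC 1; rewrite normr1 mulr1; apply: le_trans.
have pos t : 0 <= t -> f t = t * f 1.
  move=> t0; apply/eqP; rewrite -subr_eq0 -normr_le0; apply/ler_addgt0Pl => e e0.
  rewrite addr0; set d := `|_|.
  pose n := (Num.truncn ((C + C) / e)).+1.
  have n0 : (0 : R) < n%:R by rewrite ltr0n.
  have nP : (C + C) / e < n%:R by exact: truncnS_gt.
  pose k := Num.truncn (n%:R * t).
  have nt0 : 0 <= n%:R * t by rewrite mulr_ge0.
  have /andP[kl kr] := truncn_itv nt0; rewrite -/k in kl kr.
  have kr' : n%:R * t - k%:R < 1 by rewrite ltrBlDl natr1.
  have kl' : 0 <= n%:R * t - k%:R by rewrite subr_ge0.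
  have : n%:R * d <= C + C.
    rewrite /d -[X in X * _](ger0_norm (ltW n0)) -normrM mulrBr -fn mulrA.
    have -> : f (n%:R * t) - n%:R * t * f 1 =
      f (n%:R * t - k%:R) - (n%:R * t - k%:R) * f 1.
      have -> : k%:R = k%:R * 1 :> R by rewrite mulr1.
      by rewrite fD fN fn !mulr1; ring.
    apply: (le_trans (ler_normB _ _)); apply: lerD.
      by apply: (le_trans (fC _)); rewrite ger0_norm// ler_piMr// ltW.
    rewrite normrM ger0_norm//; have := fC 1; rewrite normr1 mulr1.
    by move=> f1; apply: le_trans f1; rewrite ler_piMl// ltW.
  rewrite mulrC -ler_pdivlMr// => /le_trans; apply.
  by rewrite ler_pdivrMr// mulrC -ler_pdivrMr// ltW.
move=> t; have [/pos//|t0] := lerP 0 t.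
by rewrite -[t]opprK fN pos ?oppr_ge0 ?(ltW t0)// !mulNr.
Qed.

(** * The complex inner product *)

Section complex_inner_product.
Context {R : realType} {V : normedModType R[i]}.
Hypothesis PL : parallelogram V.
Implicit Types x y z : V.

Lemma ripZrl (r : R) x y : rip (r%:C *: x) y = r * rip x y.
Proof.
have -> : rip x y = rip (1%:C *: x) y by rewrite scale1r.
apply: (@additive_linear _ (fun r => rip (r%:C *: x) y) (nrm x * nrm y)).
  by move=> s t; rewrite scaleRD ripDl.
move=> t; rewrite (le_trans (rip_norm_le PL _ _))// nrmZr.
by rewrite [leRHS]mulrC mulrA.
Qed.

Lemma nrmi x : nrm ('i *: x) = nrm x.
Proof. by rewrite nrmZ normc_def /= expr0n expr1n add0r sqrtr1 mul1r. Qed.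

Lemma ripil x y : rip ('i *: x) y = - rip x ('i *: y).
Proof.
have p : nrm ('i *: x + y) = nrm (x - 'i *: y).
  by rewrite -nrmi scalerDr scalerA -expr2 sqr_i scaleN1r addrC nrmB.
have m : nrm ('i *: x - y) = nrm (x + 'i *: y).
  by rewrite -nrmi scalerBr scalerA -expr2 sqr_i scaleN1r -opprD nrmN.
by rewrite /rip p m; ring.
Qed.

Lemma complex_scaleE (a : R[i]) x :
  a *: x = (complex.Re a)%:C *: x + (complex.Im a)%:C *: ('i *: x).
Proof. by rewrite {1}[a]complexE mulrC scalerDl scalerA. Qed.

Lemma ripZl (a : R[i]) x y : rip (a *: x) y = rip x (a^* *: y).
Proof.
case: a => s t; rewrite (complex_scaleE _ x) (complex_scaleE _ y) /=.
by rewrite ripDl// ripDr// !ripZrl !(ripC x) !ripZrl (ripC _ x) ripil (ripC _ x); ring.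
Qed.

Lemma ripZr (a : R[i]) x y : rip x (a *: y) = rip (a^* *: x) y.
Proof. by rewrite ripZl conjCK. Qed.

(** For a form linear in its first argument, Im<x, y> = Re<x, i y>. *)
Definition polar_form x y : R[i] := rip x y +i* rip x ('i *: y).

End complex_inner_product.

Section complex_parts.
Context {R : realType}.
Implicit Types a b : R[i].

Lemma ReD a b : complex.Re (a + b) = complex.Re a + complex.Re b.
Proof. by case: a b => [? ?] [? ?]. Qed.

Lemma ReN a : complex.Re (- a) = - complex.Re a.
Proof. by case: a. Qed.

Lemma complex_ext a b :
  complex.Re a = complex.Re b -> complex.Im a = complex.Im b -> a = b.
Proof. by case: a b => [? ?] [? ?] /= -> ->. Qed.

End complex_parts.

Section hilbert.
Context {R : realType} {X : completeNormedModType R[i]}.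

Lemma is_hilbertP : is_hilbert X <-> parallelogram X.
Proof.
split=> [[ip ipE] x y|PL].
  have E v : nrm v ^+ 2 = complex.Re (ip v v).
    by rewrite -ipE -nrmE -rmorphXn.
  rewrite !E !(linearDl, linearDr, linearNl, linearNr) /= opprK.
  by rewrite !(ReD, ReN); ring.
pose f : X -> X -> R[i] := polar_form.
have fC x y : f x y = Num.conj (f y x).
  apply: complex_ext; rewrite /= ?(ripC x y)//.
  by rewrite ripC ripil.
have ripii (x y : X) : rip ('i *: x) ('i *: y) = rip x y.
  by rewrite ripil scalerA -expr2 sqr_i scaleN1r ripNr// opprK.
have flin (y : X) : GRing.linear_for *%R (f ^~ y).
  move=> [s t] u v; rewrite /f /polar_form (complex_scaleE _ u) /=.
  rewrite !ripDl// !ripZrl// ripii ripil.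
  by apply: complex_ext => /=; ring.
have fl : bilinear_for *%R (Num.conj \; *%R) f.
  split=> [y|x a u v]; first exact: flin.
  by rewrite fC flin rmorphD rmorphM /= -!fC.
have fh x y : f x y = (-1) ^+ false * Num.conj (f y x).
  by rewrite expr0 mul1r.
have fxx (x : X) : f x x = `|x| ^+ 2.
  rewrite -nrmE -rmorphXn -ripxx//; apply: complex_ext => //=.
  by have := ripil x x; rewrite (ripC _ x); lra.
have fd u : u != 0 -> 0 < f u u.
  by move=> u0; rewrite fxx exprn_gt0 ?normr_gt0.
pose b := bilinear_isBilinear.Build _ _ _ _ _ _ f fl.
pose h := isHermitianSesquilinear.Build _ _ _ _ f fh.
pose d := isDotProduct.Build _ _ f fd.
pose F : {dot X for Num.conj} := HB.pack f b h d.
by exists F => x; rewrite -fxx.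
Qed.
End hilbert.

(** Completeness for nested sets of shrinking diameter. The sets are not assumed closed, so [l] is
    only approached from within each of them. They will be sets of near minimizers or of approximate
    fixed points. *)
Lemma cantor_intersection {R : realType} {V : completeNormedModType R[i]}
    (S : R -> set V) :
  (forall e, 0 < e -> S e !=set0) ->
  (forall e e', 0 < e -> e <= e' -> S e `<=` S e') ->
  (forall d, 0 < d -> exists2 e, 0 < e &
     forall x y, S e x -> S e y -> nrm (x - y) < d) ->
  exists l, forall d e, 0 < d -> 0 < e -> exists2 x, S e x & nrm (l - x) < d.
Proof.
move=> S0 Sle Sdiam.
have FF : ProperFilter (filter_from [set e : R | 0 < e] S).
  apply: filter_from_proper => [|e /S0//]; apply: filter_from_filter.
    by exists 1 => /=.
  move=> e e' /= e0 e'0; exists (Num.min e e') => /=; first by rewrite lt_min e0.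
  by move=> x Sx; split; apply: Sle Sx; rewrite ?lt_min ?e0 ?ge_min ?lexx ?orbT.
have /cauchy_cvg/cvg_ex[l /cvg_nrmP lP] : cauchy (filter_from [set e : R | 0 < e] S).
  apply/cauchy_nrmP => d /Sdiam[e e0 eS]; exists (S e) => //.
  by exists e.
exists l => d e /lP[e' /= e'0 e'S] e0.
have m0 : 0 < Num.min e e' by rewrite lt_min e0.
have [x Sx] := S0 _ m0; exists x.
  by apply: Sle Sx => //; rewrite ge_min lexx.
by apply: e'S; apply: Sle Sx => //; rewrite ge_min lexx orbT.
Qed.

(** * Riesz representation and adjoints *)

Section riesz.
Context {R : realType} {V : completeNormedModType R[i]}.
Hypothesis PL : parallelogram V.

Lemma rip_eq0 (z : V) : (forall x, rip x z = 0) -> z = 0.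
Proof.
move=> /(_ z); rewrite ripxx// => /eqP.
by rewrite sqrf_eq0 => /eqP; exact: nrm0_eq0.
Qed.

Lemma rip_inj (z z' : V) : (forall x, rip x z = rip x z') -> z = z'.
Proof.
move=> H; apply/eqP; rewrite -subr_eq0; apply/eqP/rip_eq0 => x.
by rewrite ripDr// ripNr// H subrr.
Qed.

(** The representing vector minimizes |x|^2 - 2 phi(x): the parallelogram law makes near minimizers
    close to each other, and the first order condition at the minimum is phi = <., z>. *)
Lemma riesz (phi : V -> R) (M : R) :
  {morph phi : x y / x + y} -> (forall (r : R) x, phi (r%:C *: x) = r * phi x) ->
  (forall x, `|phi x| <= M * nrm x) ->
  exists z, forall x, phi x = rip x z.
Proof.
move=> phiD phiZ phiM.
pose F x := nrm x ^+ 2 - 2 * phi x.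
have Fge x : - M ^+ 2 <= F x.
  have := phiM x; rewrite ler_norml => /andP[_].
  by have := sqr_ge0 (nrm x - M); rewrite /F; nra.
have hF : has_inf (range F).
  by split; [exists (F 0), 0|exists (- M ^+ 2) => _ [x _ <-]].
set m := inf (range F).
have mF x : m <= F x by apply: ge_inf; [case: hF|exists x].
(* Compare [m] with the value of [F] at the midpoint of [x] and [y]. *)
have diam x y : nrm (x - y) ^+ 2 <= 2 * (F x - m) + 2 * (F y - m).
  have := mF ((2^-1)%:C *: (x + y)).
  rewrite /F phiZ phiD nrmZr exprMn real_normK ?num_real// exprVn.
  by have := PL x y; lra.
have [|e e' _ ee' x /=|d d0|l lP] := @cantor_intersection R V (fun e => [set x | F x < m + e]).
- by move=> e e0; have [_ [x _ <-] ?] := inf_adherent e0 hF; exists x.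
- by move=> /lt_le_trans; apply; rewrite lerD2l.
- exists (d ^+ 2 / 4); first by rewrite divr_gt0// exprn_gt0.
  move=> x y /= Fx Fy; rewrite -ltr_sqr ?nnegrE ?nrm_ge0 ?ltW//.
  apply: le_lt_trans (diam x y) _; move: Fx Fy; lra.
exists l => x; set B := phi x - rip x l.
(* The right side is F(l + t x) - F(l). Since [l] is only a limit, it is estimated through a near
   minimizer [y] close to [l]. *)
have key t : 0 <= t ^+ 2 * nrm x ^+ 2 - 2 * t * B.
  apply/ler_addgt0Pl => h h0; pose N := 4 * `|t| * nrm x + 1.
  have N0 : 0 < N by rewrite ltr_wpDl// !mulr_ge0// nrm_ge0.
  have [y /= Fy ly] := lP (h / 2 / N) (h / 2) ltac:(by rewrite !divr_gt0) ltac:(by rewrite divr_gt0).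
  have := mF (y + t%:C *: x).
  rewrite /F phiD phiZ sqr_nrmD// ripC ripZrl// nrmZr exprMn real_normK ?num_real//.
  have := rip_norm_le PL x (l - y).
  have {}ly : nrm (l - y) * N <= h / 2 by rewrite -ler_pdivlMr// ltW.
  rewrite ripDr// ripNr// => xly.
  have {}xly : `|t * (rip x l - rip x y)| <= `|t| * nrm x * nrm (l - y).
    by rewrite normrM -mulrA ler_wpM2l.
  have := ler_norm (t * (rip x l - rip x y)).
  have := nrm_ge0 (l - y); move: Fy ly xly; rewrite /F /N /B.
  have := ler_norm (- (t * (rip x l - rip x y))); rewrite normrN.
  lra.
apply/eqP; rewrite -subr_eq0 -/B -sqrf_eq0; apply/eqP/le_anti; rewrite sqr_ge0 andbT.
(* At this [t] the quadratic in [key] is negative unless [B = 0]; adding 1 keeps the denominator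
   positive when [x = 0]. *)
have := key (B / (nrm x ^+ 2 + 1)); set N := nrm x ^+ 2.
have N0 : 0 <= N := sqr_ge0 _.
have N1 : 0 < N + 1 by rewrite ltr_wpDl.
have -> : (B / (N + 1)) ^+ 2 * N - 2 * (B / (N + 1)) * B =
   - (B ^+ 2 * ((N + 2) / (N + 1) ^+ 2)).
  by field; rewrite gt_eqF.
rewrite oppr_ge0 pmulr_lle0// divr_gt0 ?exprn_gt0//.
by rewrite ltr_wpDl.
Qed.

End riesz.

Section adjoint.
Context {R : realType} {V W : completeNormedModType R[i]}.
Hypotheses (PV : parallelogram V) (PW : parallelogram W).

(** [T' y] represents x -> <T x, y>, and its norm is bounded through |T' y|^2 = <T T' y, y>. *)
Lemma hilbert_adjoint (T : bop V W) : exists T' : bop W V,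
  (forall x y, rip (T x) y = rip x (T' y)) /\ opnorm T' <= opnorm T.
Proof.
have ex y : exists z, forall x, rip (T x) y = rip x z.
  apply: (riesz PV (M := opnorm T * nrm y)) => [u v|r u|u].
  - by rewrite linearD ripDl.
  - by rewrite linearZ ripZrl.
  - by rewrite (le_trans (rip_norm_le PW _ _))// mulrAC ler_wpM2r ?nrm_ge0 ?opnormP.
have [g gP] := choice ex.
have gl : linear g.
  move=> a y z; apply: (rip_inj PV) => x.
  rewrite -gP !ripDr// (gP z); congr (_ + _).
  by rewrite !ripZr// -linearZ gP.
have gM y : nrm (g y) <= opnorm T * nrm y.
  have [g0|g0] := eqVneq (nrm (g y)) 0.
    by rewrite g0 mulr_ge0 ?opnorm_ge0 ?nrm_ge0.
  have gp : 0 < nrm (g y) by rewrite lt0r g0 nrm_ge0.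
  rewrite -(ler_pM2l gp) -expr2 -ripxx// -gP.
  rewrite (le_trans (rip_le PW _ _))// mulrA ler_wpM2r ?nrm_ge0//.
  by rewrite mulrC opnormP.
have gb : g \in @bounded_linear R W V.
  by apply/asboolP; split=> //; exists (opnorm T).
exists (Bop gb); split; first exact: (fun x y => gP y x).
exact: (@opnorm_le _ _ _ (Bop gb) _ (opnorm_ge0 T) gM).
Qed.

End adjoint.

(** * Linear functionals and the dual of a Hilbert space *)

Lemma phase {R : realType} (a : R[i]) : exists2 u : R[i], `|u| = 1 & u * a = `|a|.
Proof.
have [->|a0] := eqVneq a 0; first by exists 1; rewrite ?normr1// mulr0 normr0.
exists (`|a| / a); last by rewrite divfK.
by rewrite normrM normfV normr_id divff// normr_eq0.
Qed.

Section functionals.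
Context {R : realType} {X : normedModType R[i]}.

(* f may be rotated so as to be real and nonnegative at a given point. *)
Lemma functional_le (f : X -> R[i]) (M : R) :
  (forall a x, f (a *: x) = a * f x) ->
  (forall x, complex.Re (f x) <= M * nrm x) ->
  forall x, nrm (f x) <= M * nrm x.
Proof.
move=> fZ fM x; have [u u1 ux] := phase (f x).
by have := fM (u *: x); rewrite nrmZ u1 mul1r fZ ux.
Qed.

(** Im f(x) = - Re f(i x) recovers the imaginary part. *)
Lemma functional_ext (f g : bop X R[i]) :
  (forall x, complex.Re (f x) = complex.Re (g x)) -> f = g.
Proof.
move=> fg; apply: bopext => x; apply: complex_ext; first exact: fg.
have := fg ('i *: x); rewrite !linearZ /= => H.
have E (a : R[i]) : complex.Im a = - complex.Re ('i *: a).
  by case: a => s t /=; rewrite mul0r mul1r sub0r opprK.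
by rewrite !E H.
Qed.

End functionals.

Section dual.
Context {R : realType} {X : completeNormedModType R[i]}.
Hypothesis PL : parallelogram X.

(** Only the real part is represented, since [rip] is real. The correspondence is isometric and
    additive, which carries the parallelogram law to the dual. *)
Lemma functional_rep (f : banach_dual X) :
  exists z, (forall x, complex.Re (f x) = rip x z) /\ nrm f = nrm z.
Proof.
have [|r x|x|z zP] := @riesz R X PL (fun x => complex.Re (f x)) (nrm f).
- by move=> x y; rewrite linearD ReD.
- by rewrite linearZ /=; case: (f x) => s t /=; rewrite mul0r subr0.
- exact: le_trans (Re_le_normc _) (opnormP f x).
exists z; split=> //; apply/eqP; rewrite eq_le; apply/andP; split.
  apply: opnorm_le => [|x]; first exact: nrm_ge0.
  apply: functional_le => [a|] {}x; first by rewrite linearZ.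
  by rewrite zP mulrC rip_le.
have [->|z0] := eqVneq (nrm z) 0; first exact: nrm_ge0.
have zp : 0 < nrm z by rewrite lt0r z0 nrm_ge0.
rewrite -(ler_pM2r zp) -expr2 -ripxx// -zP.
exact: le_trans (ler_norm _) (le_trans (Re_le_normc _) (opnormP f z)).
Qed.

Lemma functional_rep_nrm (f : banach_dual X) z :
  (forall x, complex.Re (f x) = rip x z) -> nrm f = nrm z.
Proof.
have [w [wP ->]] := functional_rep f => fz.
by rewrite (rip_inj PL (z := w) (z' := z))// => x; rewrite -wP fz.
Qed.

Lemma functional_rep_rip (f g : banach_dual X) y z :
  (forall x, complex.Re (f x) = rip x y) -> (forall x, complex.Re (g x) = rip x z) ->
  rip f g = rip y z.
Proof.
move=> fy gz.
rewrite /rip (@functional_rep_nrm (f + g) (y + z)) ?(@functional_rep_nrm (f - g) (y - z))// => x.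
  by rewrite bopBE ReD ReN fy gz ripDr// ripNr.
by rewrite bopDE ReD fy gz ripDr.
Qed.

Lemma dual_parallelogram : parallelogram (banach_dual X).
Proof.
move=> f g; have [y [yP fy]] := functional_rep f; have [z [zP gz]] := functional_rep g.
rewrite fy gz -PL (@functional_rep_nrm (f + g) (y + z)) ?(@functional_rep_nrm (f - g) (y - z))// => x.
  by rewrite bopBE ReD ReN yP zP ripDr// ripNr.
by rewrite bopDE ReD yP zP ripDr.
Qed.

End dual.

(** If [g] represents [Phi], [z] represents [g] and [y] represents [f], then Re Phi(f) = <f, g> =
    <y, z> = Re f(z), all products being real. *)
Lemma hilbert_reflexive {R : realType} (X : completeNormedModType R[i]) :
  parallelogram X -> reflexive_space X.
Proof.
move=> PL Phi; have PD := dual_parallelogram PL.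
have [g [gP _]] := functional_rep PD Phi.
have [z [zP _]] := functional_rep PL g.
exists z; apply: functional_ext => f /=.
have [y [yP _]] := functional_rep PL f.
by rewrite gP (functional_rep_rip PL yP zP) yP ripC.
Qed.

Lemma expr_lt_eps {R : realType} (r e : R) :
  0 <= r -> r < 1 -> 0 < e -> exists N, r ^+ N < e.
Proof.
move=> r0 r1 e0; have r1' : `|r| < 1 by rewrite ger0_norm.
have /cvgrPdist_lt/(_ _ e0)[N _ NP] := cvg_expr r1'.
exists N; have := NP N (leqnn N); rewrite /= sub0r normrN ger0_norm//.
exact: exprn_ge0.
Qed.

(** * Square roots of operators *)

Section square_root.
Context {R : realType} {V : completeNormedModType R[i]}.
Hypothesis PL : parallelogram V.

Let symmetric (Y : bop V V) := forall x y, rip (Y x) y = rip x (Y y).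

(* J = 1 - Y where Y is the fixed point of Y |-> (A + Y^2) / 2. *)
Lemma symmetric_sqrt (A : bop V V) : symmetric A -> opnorm A < 1 ->
  exists2 J : bop V V, symmetric J & forall x, J (J x) = x - A x.
Proof.
move=> Asym A1; set r := opnorm A; have r0 : 0 <= r := opnorm_ge0 A.
have r1 : r < 1 := A1.
pose Phi Y : bop V V := (2^-1)%:C *: (A + bop_comp Y Y).
(* [Phi] preserves [K] because (r + r^2) / 2 <= r, and contracts it by the factor [r] because Y^2 -
   Z^2 = Y (Y - Z) + (Y - Z) Z. *)
pose K := [set Y : bop V V | nrm Y <= r /\ symmetric Y].
have normh Y : nrm ((2^-1)%:C *: Y : bop V V) = nrm Y / 2.
  by rewrite nrmZr ger0_norm// mulrC.
have PhiK Y : K Y -> K (Phi Y).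
  move=> [Yr Ysym]; split=> [|x y].
    rewrite normh ler_pdivrMr// mulr_natr mulr2n (le_trans (nrmD _ _))// lerD//.
    rewrite (le_trans (opnorm_comp _ _))// (le_trans _ Yr)//.
    by rewrite ler_piMr ?opnorm_ge0// (le_trans Yr)// ltW.
  have E z : Phi Y z = (2^-1)%:C *: (A z + Y (Y z)) by [].
  by rewrite !E ripZrl// [rip x _]ripC ripZrl// [rip _ x]ripC ripDl// ripDr// -!Ysym -Asym.
have PhiL Y Z : K Y -> K Z -> nrm (Phi Y - Phi Z) <= r * nrm (Y - Z).
  move=> [Yr _] [Zr _].
  have -> : Phi Y - Phi Z = (2^-1)%:C *: (bop_comp Y (Y - Z) + bop_comp (Y - Z) Z).
    rewrite -scalerBr; congr (_ *: _); apply: bopext => x.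
    rewrite -[LHS]/(A x + Y (Y x) - (A x + Z (Z x))).
    rewrite -[RHS]/(Y (Y x - Z x) + (Y (Z x) - Z (Z x))).
    by rewrite linearB addrA subrK opprD addrACA subrr add0r.
  rewrite normh ler_pdivrMr// mulr_natr mulr2n (le_trans (nrmD _ _))// lerD//.
    by rewrite (le_trans (opnorm_comp _ _))// ler_wpM2r ?opnorm_ge0.
  by rewrite (le_trans (opnorm_comp _ _))// mulrC ler_wpM2r ?opnorm_ge0.
have K0 : K 0.
  by split=> [|x y]; rewrite ?nrm0// /= rip0l ripC rip0l.
pose S e := [set Y : bop V V | K Y /\ nrm (Phi Y - Y) < e].
have [e e0|e e' _ ee' Y [KY Ye]|d d0|L LP] := @cantor_intersection R (bop V V) S.
- have Kn n : K (iter n Phi 0) by elim: n => //= n; exact: PhiK.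
  have dn n : nrm (Phi (iter n Phi 0) - iter n Phi 0) <= r ^+ n.
    elim: n => [|n IH].
      rewrite expr0 subr0 normh /= (le_trans (ler_wpM2r _ (nrmD _ _)))//.
      have -> : @bop_comp _ V V V 0 0 = 0 by exact: bopext.
      by rewrite nrm0 addr0 nrm_bop -/r; lra.
    by rewrite /= exprS (le_trans (PhiL _ _ _ _))//= ?ler_wpM2l//; exact: PhiK.
  have [N rN] := expr_lt_eps r0 r1 e0.
  by exists (iter N Phi 0); split=> //; exact: le_lt_trans (dn N) rN.
- by split=> //; exact: lt_le_trans ee'.
(* On [K], (1 - r) |Y - Z| <= |Phi Y - Y| + |Phi Z - Z|, so approximate fixed points are close to
   each other. *)
- exists (d * (1 - r) / 4); first by rewrite !(divr_gt0, mulr_gt0)// subr_gt0.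
  move=> Y Z [KY Ye] [KZ Ze].
  have := nrm_triangle (Phi Y) Y Z; have := nrm_triangle (Phi Z) (Phi Y) Z.
  rewrite (nrmB Y (Phi Y)) => h1 h2; have h3 := PhiL _ _ KY KZ.
  have q0 : 0 < d * (1 - r) by rewrite mulr_gt0// subr_gt0.
  have : nrm (Y - Z) * (1 - r) < d * (1 - r).
    move: h1 h2 h3 Ye Ze; move: (nrm (Phi Y - Phi Z)) (nrm (Phi Y - Z)) => a b.
    by move: (nrm (Phi Y - Y)) (nrm (Phi Z - Z)) (nrm (Y - Z)) => *; lra.
  by rewrite ltr_pM2r// subr_gt0.
have KL : K L.
  split=> [|x y].
    apply/ler_addgt0Pl => d d0; have [Y [[Yr _] _] Yd] := LP d 1 d0 ltr01.
    have := nrmD (L - Y) Y; rewrite subrK; lra.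
  apply/eqP; rewrite -subr_eq0 -normr_le0; apply/ler_addgt0Pl => d d0; rewrite addr0.
  pose M := 2 * (nrm x * nrm y) + 1.
  have M0 : 0 < M by rewrite ltr_wpDl// !mulr_ge0// nrm_ge0.
  have [Y [[_ Ysym] _] Yd] := LP (d / M) 1 ltac:(by rewrite divr_gt0) ltr01.
  have -> : rip (L x) y - rip x (L y) = rip ((L - Y) x) y - rip x ((L - Y) y).
    by rewrite !bopBE ripDl// ripNl// ripDr// ripNr// Ysym; ring.
  have h1 := rip_norm_le PL ((L - Y) x) y; have h2 := rip_norm_le PL x ((L - Y) y).
  have h3 : nrm ((L - Y) x) * nrm y <= nrm (L - Y) * nrm x * nrm y.
    by rewrite ler_wpM2r ?nrm_ge0// opnormP.
  have h4 : nrm x * nrm ((L - Y) y) <= nrm x * (nrm (L - Y) * nrm y).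
    by rewrite ler_wpM2l ?nrm_ge0// opnormP.
  apply: (le_trans (ler_normB _ _)).
  have : nrm (L - Y) * M <= d by rewrite -ler_pdivlMr// ltW.
  have := nrm_ge0 (L - Y); rewrite /M; lra.
have fixL : Phi L = L.
  apply/eqP; rewrite -subr_eq0; apply/eqP/nrm_small0 => e e0.
  have e30 : 0 < e / 3 by rewrite divr_gt0.
  have [Y [KY Ye] Yd] := LP (e / 3) (e / 3) e30 e30.
  have := nrm_triangle (Phi Y) (Phi L) L; have := nrm_triangle Y (Phi Y) L.
  rewrite (nrmB Y L); have := PhiL _ _ KL KY.
  have : r * nrm (L - Y) <= nrm (L - Y) by rewrite ler_piMl ?nrm_ge0// ltW.
  move: Ye Yd; move: (nrm (Phi L - Phi Y)) (nrm (Phi L - L)) (nrm (Phi Y - L)) => a b c.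
  by move: (nrm (Phi Y - Y)) (nrm (L - Y)) => *; lra.
exists (bop_id - L) => [x y|x].
  by rewrite !bopBE ripDl// ripNl// ripDr// ripNr// KL.2.
have two : L x + L x = A x + L (L x).
  have E : L x = (2^-1)%:C *: (A x + L (L x)) by rewrite -[in LHS]fixL.
  rewrite [in LHS]E -scaleRD.
  have -> : 2^-1 + 2^-1 = 1 :> R by field.
  by rewrite scale1r.
have -> : x - A x = x - L x - (L x - L (L x)).
  rewrite opprB (addrA (x - _)) (addrAC (x - _)) -(addrA x) -opprD two.
  by rewrite opprD addrA subrK.
by rewrite -linearB.
Qed.

(** [J] is the symmetric square root of I - T' T, and |J x|^2 = <J^2 x, x>. *)
Lemma defect_root (T : bop V V) : opnorm T < 1 ->
  exists J : bop V V, forall x, nrm (J x) ^+ 2 = nrm x ^+ 2 - nrm (T x) ^+ 2.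
Proof.
move=> T1; have [T' [TP TT]] := hilbert_adjoint PL PL T.
have [||J Jsym JP] := @symmetric_sqrt (bop_comp T' T).
- by move=> x y; rewrite /= ripC -TP ripC TP.
- rewrite (le_lt_trans (opnorm_comp _ _))// (le_lt_trans _ T1)//.
  by rewrite ler_piMl ?opnorm_ge0// (le_trans TT)// ltW.
exists J => x; rewrite -!ripxx// Jsym JP TP.
by rewrite ripDr// ripNr.
Qed.

End square_root.

(** * The l_2 norm and the shifts *)

Section ell2_norm.
Context {R : realType} {I : choiceType} {Y : normedModType R[i]}.

Lemma sqr_nrm_ell2 (y : ell2 I Y) : ((nrm y ^+ 2)%:E = sqsum y)%E.
Proof.
have yfin : (sqsum y < +oo)%E by have := ell2P y.
rewrite nrm_ell2 sqr_sqrtr ?fine_ge0 ?sqsum_ge0// fineK//.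
by rewrite ge0_fin_numE ?sqsum_ge0.
Qed.

(** The law is summed termwise in the extended reals, where [esum] is additive on nonnegative
    terms. *)
Lemma ell2_parallelogram : parallelogram Y -> parallelogram (ell2 I Y).
Proof.
move=> PL x y; apply/EFin_inj.
rewrite mulrDl !mul1r !EFinD !sqr_nrm_ell2 /sqsum.
rewrite -!esumD; do ?[by move=> i _; rewrite ?adde_ge0// lee_fin sqr_ge0].
by apply: eq_esum => i _; rewrite -!EFinD ell2DE ell2BE PL mulrDl !mul1r.
Qed.

Lemma finite_support_ell2 (s : seq I) (y : I -> Y) : uniq s ->
  (forall i, i \notin s -> y i = 0) ->
  y \in square_summable /\ l2norm y ^+ 2 = \sum_(i <- s) nrm (y i) ^+ 2.
Proof.
move=> us ys.
have E : sqsum y = (\sum_(i <- s) nrm (y i) ^+ 2)%:E.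
  rewrite /sqsum -sumEFin fsbig_seq// -esum_fset// => [|i _]; last first.
    by rewrite lee_fin sqr_ge0.
  rewrite [RHS]esum_mkcond; apply: eq_esum => i _.
  case: ifPn => //; rewrite notin_setE /= => /negP/ys ->.
  by rewrite nrm0 expr0n.
split; first by rewrite inE E ltry.
by rewrite /l2norm E /= sqr_sqrtr// sumr_ge0// => i _; exact: sqr_ge0.
Qed.

End ell2_norm.

Lemma sqr_nrm_backward_shift {R : realType} {Y : normedModType R[i]}
    (w : ell2 nat Y) :
  nrm w ^+ 2 = nrm (w 0) ^+ 2 + nrm (backward_shift w) ^+ 2.
Proof.
apply/EFin_inj; rewrite EFinD !sqr_nrm_ell2 /sqsum.
have w0 i : (0 <= (nrm (w i) ^+ 2)%:E)%E by rewrite lee_fin sqr_ge0.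
rewrite (esumID [set 0]) => [|i _]; last exact: w0.
rewrite !setTI esum_set1//; congr (_ + _)%E.
rewrite (reindex_esum setT _ S)//; split=> //.
- by move=> i j _ _ [].
- by case=> [[]|n _] //; exists n.
Qed.

Lemma sqr_nrm_unilateral_shift {R : realType} {Y : normedModType R[i]}
    (w z : ell2 nat Y) :
  nrm (unilateral_shift w + z) ^+ 2 = nrm (z 0) ^+ 2 + nrm (w + backward_shift z) ^+ 2.
Proof.
rewrite sqr_nrm_backward_shift -[(_ + z) 0]/(0 + z 0) add0r.
by congr (_ + nrm _ ^+ 2); exact: ell2ext.
Qed.

(** The two shifts are adjoint to each other: coordinate 0 adds the same |z_0|^2 to both squares in
    [rip] and cancels. *)
Lemma rip_unilateral_shift {R : realType} {Y : normedModType R[i]}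
    (w z : ell2 nat Y) : rip (unilateral_shift w) z = rip w (backward_shift z).
Proof.
rewrite /rip (sqr_nrm_unilateral_shift w z) (sqr_nrm_unilateral_shift w (- z)).
have -> : backward_shift (- z) = - backward_shift z by exact: ell2ext.
by rewrite -[(- z) 0]/(- z 0) nrmN; ring.
Qed.

Lemma ler_sum_uniq {R : realType} (I : eqType) (s t : seq I) (F : I -> R) :
  uniq s -> uniq t -> {subset s <= t} -> (forall i, 0 <= F i) ->
  \sum_(i <- s) F i <= \sum_(i <- t) F i.
Proof.
move=> us ut st F0.
have /(perm_big _) <- : perm_eq [seq i <- t | i \in s] s.
  apply: uniq_perm => // [|i]; first exact: filter_uniq.
  by rewrite mem_filter; apply: andb_idr; exact: st.
by rewrite big_filter [leRHS](bigID (mem s))/= lerDl sumr_ge0.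
Qed.

(** For W x = (J T^n x)_n the squares |J T^n x|^2 = |T^n x|^2 - |T^(n+1) x|^2 telescope, with sum
    |x|^2 because T^n x tends to 0. *)
Lemma backward_shift_iso {R : realType} (X : completeNormedModType R[i])
    (T : bop X X) : parallelogram X -> opnorm T < 1 ->
  exists W : bop X (ell2 nat X),
    (forall x, nrm (W x) = nrm x) /\ forall x, backward_shift (W x) = W (T x).
Proof.
move=> PL T1; have [J JP] := defect_root PL T1.
pose w x n := J (iter n T x).
have wsum x N : \sum_(0 <= n < N) nrm (w x n) ^+ 2 = nrm x ^+ 2 - nrm (iter N T x) ^+ 2.
  elim: N => [|N IH]; first by rewrite big_geq// subrr.
  by rewrite big_nat_recr//= IH JP; ring.
have wss x : w x \in square_summable /\ l2norm (w x) <= nrm x.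
  apply: l2norm_le => [|s us]; first exact: nrm_ge0.
  pose N := (\max_(n <- s) n).+1.
  apply: (@le_trans _ _ (\sum_(0 <= n < N) nrm (w x n) ^+ 2)).
    apply: ler_sum_uniq => [//||n ns|n]; first exact: iota_uniq.
      by rewrite mem_index_iota ltnS leq_bigmax_seq.
    exact: sqr_ge0.
  by rewrite wsum gerBl sqr_ge0.
have iterT x n : nrm (iter n T x) <= opnorm T ^+ n * nrm x.
  elim: n => [|n IH]; first by rewrite expr0 mul1r.
  by rewrite /= exprS -mulrA (le_trans (opnormP _ _))// ler_wpM2l ?opnorm_ge0.
have wnorm x : l2norm (w x) = nrm x.
  apply/eqP; rewrite eq_le (wss x).2 /= -ler_sqr ?nnegrE ?nrm_ge0 ?l2norm_ge0//.
  apply/ler_addgt0Pl => e e0.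
  have [|N TN] := @expr_lt_eps _ (opnorm T) (e / (nrm x ^+ 2 + 1)) (opnorm_ge0 T) T1.
    by rewrite divr_gt0// ltr_wpDl ?sqr_ge0.
  have := l2norm_ge (wss x).1 (iota_uniq 0 N).
  rewrite -[N in iota 0 N]subn0 wsum => h1.
  have h2 : nrm (iter N T x) ^+ 2 <= opnorm T ^+ N * nrm x ^+ 2.
    apply: (@le_trans _ _ ((opnorm T ^+ N * nrm x) ^+ 2)).
      by rewrite ler_sqr ?nnegrE ?mulr_ge0 ?exprn_ge0 ?nrm_ge0 ?opnorm_ge0.
    rewrite exprMn ler_wpM2r ?sqr_ge0// expr2 ler_piMr ?exprn_ge0 ?opnorm_ge0//.
    by rewrite exprn_ile1 ?opnorm_ge0// ltW.
  move: TN; rewrite ltr_pdivlMr ?ltr_wpDl ?sqr_ge0// => TN.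
  have : 0 <= opnorm T ^+ N by rewrite exprn_ge0 ?opnorm_ge0.
  lra.
pose W x := Ell2 (wss x).1.
have iterL n a x y : iter n T (a *: x + y) = a *: iter n T x + iter n T y.
  by elim: n => //= n ->; rewrite linearP.
have Wb : W \in @bounded_linear R X (ell2 nat X).
  apply/asboolP; split.
    by move=> a x y; apply: ell2ext => n; rewrite /= /w iterL linearP.
  by exists 1 => x; rewrite mul1r nrm_ell2 wnorm.
exists (Bop Wb); split=> x; first exact: wnorm.
by apply: ell2ext => n; rewrite /= /w -iterSr.
Qed.

(** * Contractions and their defects *)

Section contractions.
Context {R : realType} {X : completeNormedModType R[i]}.

Lemma strictly_contractiveE (T : bop X X) : strictly_contractive T <-> opnorm T < 1.
Proof. by rewrite /strictly_contractive -nrmE (ltcR _ 1). Qed.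

Lemma contractiveP (T : bop X X) : contractive T <-> forall x, nrm (T x) <= nrm x.
Proof.
rewrite /contractive -nrmE (lecR _ 1); split=> [T1 x|T1].
  by rewrite (le_trans (opnormP _ _))// ler_piMl ?nrm_ge0.
by apply: opnorm_le => // x; rewrite mul1r.
Qed.

(** Linearity of [g] makes the defect a seminorm. It is definite because |T x| = |x| with |T| < 1
    forces x = 0. *)
Lemma defect_is_norm {Y : normedModType R[i]} (T : bop X X) (g : {linear X -> Y}) :
  opnorm T < 1 -> (forall x, nrm (g x) ^+ 2 = nrm x ^+ 2 - nrm (T x) ^+ 2) ->
  is_norm (defect T).
Proof.
move=> T1 gT.
have dE x : defect T x = nrm (g x).
  by rewrite /defect -gT sqrtr_sqr ger0_norm ?nrm_ge0.
split=> [x|x|a x|x y]; rewrite !dE ?nrm_ge0 ?linearZ ?nrmZ ?linearD ?nrmD//.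
move=> gx0; apply: nrm0_eq0; apply/eqP; rewrite eq_le nrm_ge0 andbT leNgt.
apply/negP => x0; have := gT x; rewrite gx0 expr0n /= => /esym/eqP.
rewrite subr_eq0 => /eqP xT; have := opnormP T x.
have -> : nrm (T x) = nrm x.
  by apply/eqP; rewrite -(eqrXn2 (n := 2))// ?nrm_ge0// xT.
by rewrite leNgt gtr_pMl// T1.
Qed.

(** For q = z, the dilation says that W T x is the component of V W x in the range of [W]. Hence g x
    = V W x - W T x lies in [L], and Pythagoras gives |g x|^2 = |x|^2 - |T x|^2. *)
Lemma dilation_defect_is_norm {Xt : completeNormedModType R[i]} (T : bop X X)
    (V : {linear Xt -> Xt}) :
  strictly_contractive T -> isometric_dilation T V -> is_norm (defect T).
Proof.
move=> /strictly_contractiveE T1 [Viso [W [L [Wiso _ dsum WL]]]].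
pose g x := V (W x) - W (T x).
have gl : linear g.
  by move=> a x y; rewrite /g /= !linearP /= addrACA -scalerDr.
pose G : {linear X -> Xt} := HB.pack g (GRing.isLinear.Build _ _ _ _ g gl).
have polyX (A : Xt -> Xt) v : poly_map 'X A v = A v.
  rewrite /poly_map size_polyX big_ord_recl big_ord1 !coefX /= scale0r add0r.
  by rewrite scale1r.
apply: (@defect_is_norm _ _ G) => // x.
have := WL 'X (W x) (ex_intro2 _ _ x I erefl).
rewrite !polyX transportE// => VW.
have [uniq_dec pyth] := dsum.
have [[u v] [[/= Wu Lv E] _]] := uniq_dec (V (W x)).
rewrite E proj_alongE// in VW; subst u.
rewrite -[LHS]/(nrm (V (W x) - W (T x)) ^+ 2) E addrAC subrr add0r.
have := pyth _ _ Wu Lv; rewrite -E Viso !Wiso => H.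
suff : nrm x ^+ 2 = nrm (T x) ^+ 2 + nrm v ^+ 2 by move->; rewrite addrC addKr.
by apply: complexI; rewrite rmorphD !rmorphXn /= !nrmE.
Qed.

End contractions.

(** * Dilations and disk automorphisms under the parallelogram law *)

Lemma closed_kernel {R : realType} {Y Z : normedModType R[i]} (P : bop Y Z) : closed [set u | P u = 0].
Proof.
move=> u uL; apply: nrm_small0 => e e0.
pose M := opnorm P + 1; have M0 : 0 < M by rewrite ltr_wpDl ?opnorm_ge0.
have [|v [/= Pv uv]] := uL [set v | nrm (u - v) < e / M].
  by have /cvg_nrmP/(_ (e / M)) : nbhs u --> u by []; apply; rewrite divr_gt0.
rewrite -[P u]subr0 -Pv -linearB (le_trans (opnormP _ _))//.
apply: (@le_trans _ _ (nrm (u - v) * M)).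
  by rewrite mulrC ler_wpM2l ?nrm_ge0// lerDl.
by rewrite -ler_pdivlMr// ltW.
Qed.

Lemma unilateral_shift_isometry {R : realType} {Y : normedModType R[i]} (u : ell2 nat Y) :
  nrm (unilateral_shift u) = nrm u.
Proof.
apply/eqP; rewrite -(eqrXn2 (n := 2))// ?nrm_ge0//.
rewrite (sqr_nrm_backward_shift (unilateral_shift u)).
have -> : backward_shift (unilateral_shift u) = u by exact: ell2ext.
by rewrite -[_ 0]/(0 : Y) nrm0 expr0n add0r.
Qed.

Section hilbert_dilation.
Context {R : realType} {X : completeNormedModType R[i]}.
Hypothesis PL : parallelogram X.

(** [W] intertwines the adjoint [T'] with the backward shift. Passing to adjoints, with [P] the
    adjoint of [W], gives P M_z^k W = T^k. Since P W = I, the kernel of [P] is the orthogonal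
    complement of the range of [W] and serves as [L]. *)
Lemma hilbert_dilation (T : bop X X) : strictly_contractive T ->
  isometric_dilation T (unilateral_shift : {linear ell2 nat X -> ell2 nat X}).
Proof.
move=> /strictly_contractiveE T1.
have PL2 : parallelogram (ell2 nat X) := ell2_parallelogram PL.
have [T' [TP TT]] := hilbert_adjoint PL PL T.
have [W [Wiso WT]] := backward_shift_iso PL (le_lt_trans TT T1).
have [P [PP _]] := hilbert_adjoint PL PL2 W.
have Wrip x y : rip (W x) (W y) = rip x y.
  by rewrite /rip -linearD -linearB !Wiso.
have PW x : P (W x) = x.
  by apply: (rip_inj PL) => y; rewrite -PP Wrip.
have Wl x u : P u = 0 -> rip (W x) u = 0 by rewrite PP => ->; rewrite ripC rip0l.
have Piter k x : P (iter k unilateral_shift (W x)) = iter k T x.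
  apply: (rip_inj PL) => y; rewrite -PP; elim: k y => [|k IH] y; first exact: Wrip.
  by rewrite /= ripC rip_unilateral_shift WT ripC IH ripC -TP ripC.
split=> [u|]; first by rewrite -!nrmE unilateral_shift_isometry.
exists (W : {linear X -> ell2 nat X}), [set u | P u = 0].
have dsum : direct_sum2 (range W) [set u | P u = 0].
  split=> [u|_ l [x _ <-] /= Pl].
    exists (W (P u), u - W (P u)); split=> /=.
      split; [by exists (P u)|by rewrite linearB /= PW subrr|by rewrite addrC subrK].
    move=> [_ l] /= [[x _ <-] Pl ->].
    by rewrite linearD /= Pl addr0 PW [W x + l]addrC addrK.
  rewrite -!nrmE -!rmorphXn -rmorphD; congr (_%:C).
  by rewrite sqr_nrmD// Wl// mulr0 addr0.
split=> //.
- by move=> x; rewrite -!nrmE Wiso.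
- split; first exact: closed_kernel.
  split=> [|a u v]; rewrite !in_setE /= ?linear0// => Pu Pv.
  by rewrite linearP /= Pu Pv scaler0 addr0.
move=> q _ [x _ <-].
pose z := poly_map q T x.
have titer k : iter k (transport W T) (W x) = W (iter k T x).
  by elim: k => //= k ->; rewrite transportE// => y; rewrite -!nrmE Wiso.
have -> : poly_map q (transport W T) (W x) = W z.
  rewrite /z /poly_map linear_sum; apply: eq_bigr => k _.
  by rewrite titer linearZ.
have Pz : P (poly_map q unilateral_shift (W x)) = z.
  rewrite /z /poly_map linear_sum; apply: eq_bigr => k _.
  by rewrite linearZ /= Piter.
rewrite -[poly_map q unilateral_shift (W x)](subrK (W z)) addrC proj_alongE//=.
  by exists z.
by rewrite linearB /= Pz PW subrr.
Qed.

Lemma hilbert_blaschke (a : R[i]) (T : bop X X) : `|a| < 1 -> contractive T ->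
  contractive (blaschke a T).
Proof.
move=> a1 T1; have [inv _] := one_sub_scale_invertible a1 T1.
apply/contractiveP => x /=; set y := bop_inv _ x.
have <- : y - a^* *: T y = x.
  by have := congr1 (fun f : bop X X => f x) inv.
rewrite -ler_sqr ?nnegrE ?nrm_ge0// -[X in nrm X]/(T y - a *: y).
rewrite !sqr_nrmB// !nrmZ !exprMn ripZr//.
have -> : complex.Re `|a^*| = complex.Re `|a| by rewrite norm_conjC.
rewrite ripC ripZr//.
(* The cross terms agree; the difference of the two sides is (1 - |a|^2)(|y|^2 - |T y|^2), a product
   of nonnegative factors. *)
have : complex.Re `|a| ^+ 2 <= 1.
  by rewrite exprn_ile1 ?Re_norm_ge0// -lecR RRe_real ?normr_real// ltW.
have : nrm (T y) ^+ 2 <= nrm y ^+ 2.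
  by rewrite ler_sqr ?nnegrE ?nrm_ge0//; exact: (contractiveP T).1.
nra.
Qed.

End hilbert_dilation.

(** * The Hahn-Banach theorem and norming functionals *)

Section hahn_banach.
Context {R : realType} {V : lmodType R[i]}.
Implicit Types (p q : V -> R) (x y : V).

Definition sublinear p :=
  (forall x y, p (x + y) <= p x + p y) /\
  (forall t x, 0 < t -> p (t%:C *: x) <= t * p x).

Lemma sublinearZ p t x : sublinear p -> 0 < t -> p (t%:C *: x) = t * p x.
Proof.
move=> [_ pZ] t0; apply/eqP; rewrite eq_le pZ//=.
have := pZ t^-1 (t%:C *: x); rewrite invr_gt0 => /(_ t0).
rewrite scalerA -rmorphM mulVf ?gt_eqF// scale1r => H.
by rewrite -ler_pdivlMl.
Qed.

Lemma sublinear0 p : sublinear p -> p 0 = 0.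
Proof.
by move=> /(@sublinearZ _ 2 0)/(_ ltac:(by [])); rewrite scaler0; lra.
Qed.

Lemma sublinearN p x : sublinear p -> - p (- x) <= p x.
Proof.
move=> sp; rewrite lerNl -subr_ge0 opprK -(sublinear0 sp) -(subrr x) addrC.
exact: sp.1.
Qed.

(** The infimum of these numbers over t > 0 is a sublinear functional below [p], lowered along [y]:
    at [- y] it is at most [- p y]. *)
Let shears p y x := [set p (x + t%:C *: y) - t * p y | t in [set t | 0 < t]].

Definition shear p y x := inf (shears p y x).

Lemma shear_has_inf p y x : sublinear p -> has_inf (shears p y x).
Proof.
move=> sp; split; first by eexists; exists 1 => //=.
exists (- p (- x)) => _ [t /= t0 <-].
rewrite -(sublinearZ _ sp t0).
have := sp.1 (x + t%:C *: y) (- x); rewrite addrAC subrr add0r; lra.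
Qed.

Lemma shear_le p y x t : sublinear p -> 0 < t ->
  shear p y x <= p (x + t%:C *: y) - t * p y.
Proof.
move=> sp t0; apply: ge_inf; first by case: (shear_has_inf y x sp).
by exists t.
Qed.

Lemma shear_adherent p y x e : sublinear p -> 0 < e ->
  exists2 t, 0 < t & p (x + t%:C *: y) - t * p y < shear p y x + e.
Proof.
move=> sp e0; have [_ [t /= t0 <-] H] := inf_adherent e0 (shear_has_inf y x sp).
by exists t.
Qed.

Lemma shear_le_id p y x : sublinear p -> shear p y x <= p x.
Proof.
move=> sp; apply: (le_trans (shear_le y x sp ltr01)).
by rewrite scale1r mul1r lerBlDr sp.1.
Qed.

Lemma shear_sublinear p y : sublinear p -> sublinear (shear p y).
Proof.
move=> sp; split=> [x x'|t x t0]; apply/ler_addgt0Pl => e e0.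
  have e20 : 0 < e / 2 by rewrite divr_gt0.
  have [t t0 H] := shear_adherent y x sp e20.
  have [t' t'0 H'] := shear_adherent y x' sp e20.
  have := shear_le y (x + x') sp (addr_gt0 t0 t'0).
  have := sp.1 (x + t%:C *: y) (x' + t'%:C *: y).
  by rewrite addrACA -scalerDl -rmorphD; lra.
have et0 : 0 < e / t by rewrite divr_gt0.
have [s s0 H] := shear_adherent y x sp et0.
have := shear_le y (t%:C *: x) sp (mulr_gt0 t0 s0).
rewrite rmorphM -scalerA -scalerDr (sublinearZ _ sp t0) => /le_trans; apply.
move: H; rewrite -(ltr_pM2l t0) [t * (_ + e / t)]mulrDr (mulrC t (e / t)) divfK ?gt_eqF//.
lra.
Qed.

(* A minimal sublinear functional is additive because it is not diminished by
   shearing. *)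
Lemma hahn_banach p0 : sublinear p0 -> exists phi : V -> R,
  [/\ {morph phi : x y / x + y}, (forall (r : R) x, phi (r%:C *: x) = r * phi x)
    & forall x, phi x <= p0 x].
Proof.
move=> sp0.
pose T := {p : V -> R | sublinear p /\ forall x, p x <= p0 x}.
(* The order is reversed, so that a maximal element for Zorn is a minimal functional. *)
pose rel (p q : T) := `[< forall x, sval q x <= sval p x >].
have [||||[p [sp pp0]] pmin] := @Zorn T rel.
- by move=> p; apply/asboolP.
- move=> p q r /asboolP pq /asboolP qr; apply/asboolP => x.
  exact: le_trans (qr x) (pq x).
- move=> [p Pp] [q Pq] /asboolP/= pq /asboolP/= qp.
  have E : p = q by apply/funext => x; apply/le_anti; rewrite pq qp.
  by subst q; congr exist; exact: Prop_irrelevance.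
- move=> A Atot; have [[a Aa]|A0] := pselect (A !=set0); last first.
    exists (exist _ p0 (conj sp0 (fun x => lexx (p0 x)))) => p Ap.
    by case: A0; exists p.
  (* A nonempty chain is bounded by its pointwise infimum, finite because every member is at least -
     p0(- x) at [x]. *)
  pose B x := [set sval p x | p in A].
  have Binf x : has_inf (B x).
    split; first by exists (sval a x), a.
    exists (- p0 (- x)) => _ [[p [sp pp0]] /= _ <-].
    by apply: le_trans (sublinearN x sp); rewrite lerN2.
  have Ble x (q : T) : A q -> inf (B x) <= sval q x.
    by move=> Aq; apply: ge_inf; [case: (Binf x)|exists q].
  have Badh x e : 0 < e -> exists2 q : T, A q & sval q x < inf (B x) + e.
    by move=> e0; have [_ [q Aq <-] ?] := inf_adherent e0 (Binf x); exists q.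
  have sB : sublinear (fun x => inf (B x)).
    split=> [x y|t x t0]; apply/ler_addgt0Pl => e e0.
      have e20 : 0 < e / 2 by rewrite divr_gt0.
      have [q Aq qx] := Badh x _ e20; have [r Ar ry] := Badh y _ e20.
      wlog qr : x y q r Aq Ar qx ry / rel q r.
        move=> H; have [|rq] := Atot _ _ Aq Ar; first exact: H qx ry.
        by rewrite addrC [X in _ <= e + X]addrC; exact: H ry qx rq.
      apply: (le_trans (Ble _ _ Ar)); have [sr _] := svalP r.
      apply: (le_trans (sr.1 _ _)).
      have /asboolP/(_ x) := qr; lra.
    have et0 : 0 < e / t by rewrite divr_gt0.
    have [q Aq qx] := Badh x _ et0; apply: (le_trans (Ble _ _ Aq)).
    have [sq _] := svalP q; rewrite sublinearZ//.
    move: qx; rewrite -(ltr_pM2l t0) [t * (_ + e / t)]mulrDr (mulrC t (e / t)) divfK ?gt_eqF//.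
    by rewrite addrC => /ltW.
  have Bp0 x : inf (B x) <= p0 x.
    by apply: le_trans (Ble x a Aa) _; have [_] := svalP a.
  exists (exist _ (fun x => inf (B x)) (conj sB Bp0) : T) => q Aq.
  by apply/asboolP => x /=; exact: Ble.
have shearE y x : shear p y x = p x.
  have ss0 x' : shear p y x' <= p0 x' := le_trans (shear_le_id y x' sp) (pp0 x').
  pose q : T := exist _ (shear p y) (conj (shear_sublinear y sp) ss0).
  suff E : q = exist _ p (conj sp pp0) by exact: (congr1 (fun r : T => sval r x) E).
  by apply: pmin; apply/asboolP => x' /=; exact: shear_le_id.
have pD : {morph p : x y / x + y}.
  move=> x y; apply/eqP; rewrite eq_le sp.1 /=.
  by have := shear_le y x sp ltr01; rewrite shearE scale1r mul1r lerBrDr.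
exists p; split=> // r x.
have [r0|r0|<-] := ltgtP 0 r; first exact: sublinearZ.
  have pN z : p (- z) = - p z.
    by apply/eqP; rewrite -addr_eq0 -pD addNr sublinear0.
  have := sublinearZ x sp (_ : 0 < - r); rewrite oppr_gt0 => /(_ r0).
  by rewrite rmorphN scaleNr pN mulNr => /oppr_inj.
by rewrite scale0r mul0r sublinear0.
Qed.

End hahn_banach.

Section norming.
Context {R : realType} {X : normedModType R[i]}.

(** Hahn-Banach is applied to the norm sheared along [x0], whose value at [- x0] is at most - |x0|;
    this forces phi(x0) = |x0|. The complex functional is phi(x) - i phi(i x), and its value at [x0]
    is real because its modulus is at most its real part |x0|. *)
Lemma norming_functional (x0 : X) :
  exists f : bop X R[i], opnorm f <= 1 /\ f x0 = (nrm x0)%:C.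
Proof.
have sn : sublinear (@nrm R X).
  by split=> [x y|t x t0]; [exact: nrmD|rewrite nrmZr gtr0_norm].
have [phi [phiD phiZ phile]] := hahn_banach (shear_sublinear x0 sn).
have phin x : phi x <= nrm x := le_trans (phile x) (shear_le_id x0 x sn).
have phi0 : phi x0 = nrm x0.
  apply/eqP; rewrite eq_le phin /=.
  have := le_trans (phile (- x0)) (shear_le x0 (- x0) sn ltr01).
  rewrite scale1r addNr nrm0 mul1r sub0r -scaleN1r -[-1 : R[i]](rmorphN1 (real_complex R)).
  by rewrite phiZ mulN1r lerN2.
pose f x : R[i] := phi x +i* - phi ('i *: x).
have phiE a x : phi (a *: x) = complex.Re a * phi x + complex.Im a * phi ('i *: x).
  by rewrite complex_scaleE phiD !phiZ.
have fZ (a : R[i]) (x : X) : f (a *: x) = a * f x.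
  rewrite /f scalerA (phiE a) (phiE ('i * a)); case: a => s t.
  by apply: complex_ext => /=; ring.
have fD (x y : X) : f (x + y) = f x + f y.
  by rewrite /f scalerDr !phiD; apply: complex_ext => //=; ring.
have fl : linear f by move=> a x y; rewrite fD fZ.
have fle x : nrm (f x) <= 1 * nrm x.
  by apply: functional_le => // y; rewrite mul1r phin.
have fb : f \in @bounded_linear R X R[i].
  by apply/asboolP; split=> //; exists 1.
exists (Bop fb); split; first by apply: opnorm_le.
have fx0 : complex.Re (f x0) = nrm x0 by [].
apply: complex_ext => //=.
have := fle x0; rewrite mul1r -ler_sqr ?nnegrE ?nrm_ge0//.
rewrite sqr_normc fx0 => H.
by apply/eqP; rewrite -sqrf_eq0 eq_le sqr_ge0 andbT; move: H; rewrite gerDl.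
Qed.

End norming.

(** * Defects of rank one operators *)

Section rank_one.
Context {R : realType} {X : completeNormedModType R[i]}.

Lemma rank_one_bounded (f : bop X R[i]) (y : X) :
  (fun x => f x *: y) \in @bounded_linear R X X.
Proof.
apply/asboolP; split=> [a u v|]; first by rewrite linearP scalerDl scalerA.
exists (opnorm f * nrm y) => x; rewrite nrmZ mulrAC ler_wpM2r ?nrm_ge0//.
exact: (opnormP f x).
Qed.

Definition rank_one (f : bop X R[i]) (y : X) : bop X X := Bop (rank_one_bounded f y).

Lemma opnorm_rank_one f y : opnorm (rank_one f y) <= opnorm f * nrm y.
Proof.
apply: opnorm_le => [|x]; first by rewrite mulr_ge0 ?opnorm_ge0 ?nrm_ge0.
by rewrite nrmZ mulrAC ler_wpM2r ?nrm_ge0//; exact: (opnormP f x).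
Qed.

Lemma opnormZr (c : R) (f : bop X R[i]) : opnorm (c%:C *: f) = `|c| * opnorm f.
Proof. exact: (@nrmZr _ (bop X R[i])). Qed.

(** The restriction to rank one operators lets the section be applied on a dual space, where only
    adjoints are known to dilate. *)
Hypothesis defect_norm : forall (f : bop X R[i]) (y : X),
  opnorm f * nrm y < 1 -> is_norm (defect (rank_one f y)).

(* The defects of the rank one operators c f(.) x0 with c < 1 have the limit
   (|x|^2 - |f x|^2)^(1/2) as c tends to 1; this seminorm vanishes at x0, hence is
   invariant under translation by multiples of x0. *)
Lemma rank_one_defect_orthogonal (f : bop X R[i]) (x0 k : X) (b : R[i]) :
  opnorm f <= 1 -> nrm x0 = 1 -> f x0 = 1 -> f k = 0 ->
  nrm (k + b *: x0) ^+ 2 = nrm k ^+ 2 + complex.Re `|b| ^+ 2.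
Proof.
move=> f1 n0 fx0 fk.
pose N x := Num.sqrt (nrm x ^+ 2 - nrm (f x) ^+ 2).
have fle x : nrm (f x) <= nrm x.
  by rewrite (le_trans (opnormP f x))// ler_piMl ?nrm_ge0.
have Nsq x : N x ^+ 2 = nrm x ^+ 2 - nrm (f x) ^+ 2.
  by rewrite sqr_sqrtr// subr_ge0 ler_sqr ?nnegrE ?nrm_ge0.
have N0 x : 0 <= N x := sqrtr_ge0 _.
have Ntri x y : N (x + y) <= N x + N y.
  apply/ler_addgt0Pl => d d0.
  pose M := nrm x + nrm y + 1; have M0 : 0 < M by rewrite ltr_wpDl ?addr_ge0 ?nrm_ge0.
  (* With c^2 = 1 - e^2, the squared defect of c f(.) x0 at z is N(z)^2 + (e |f z|)^2. So the defect
     lies between N(z) and N(z) + e |z|, and the total error e (|x| + |y|) is at most [d]. *)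
  pose e := Num.min (d / M) 2^-1.
  have e0 : 0 < e by rewrite lt_min divr_gt0//=.
  have e1 : e < 1 by rewrite gt_min orbC invf_lt1// ltr1n.
  have eM : e * M <= d by rewrite -ler_pdivlMr// ge_min lexx.
  have e2 : 0 < e ^+ 2 < 1 by rewrite exprn_gt0//= exprn_ilt1// ltW.
  pose c := Num.sqrt (1 - e ^+ 2).
  have c2 : c ^+ 2 = 1 - e ^+ 2 by rewrite sqr_sqrtr//; lra.
  have c0 : 0 <= c := sqrtr_ge0 _.
  have c1 : c < 1 by rewrite -(@ltr_pXn2r _ 2) ?nnegrE// c2 expr1n; lra.
  have [|_ _ _ Dtri] := @defect_norm (c%:C *: f) x0.
    by rewrite opnormZr n0 mulr1 ger0_norm// (le_lt_trans _ c1)// ler_piMr.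
  have Dsq z : defect (rank_one (c%:C *: f) x0) z ^+ 2 = N z ^+ 2 + (e * nrm (f z)) ^+ 2.
    have E : nrm (rank_one (c%:C *: f) x0 z) = c * nrm (f z).
      by rewrite nrmZ n0 mulr1 -[complex.Re _]/(nrm (c%:C *: f z)) nrmZr ger0_norm.
    rewrite Nsq /defect sqr_sqrtr E exprMn c2; last first.
      have := fle z; rewrite -ler_sqr ?nnegrE ?nrm_ge0// => fz.
      have : 0 <= e ^+ 2 * nrm (f z) ^+ 2 by rewrite mulr_ge0 ?sqr_ge0.
      lra.
    by rewrite exprMn; ring.
  have D0 z : 0 <= defect (rank_one (c%:C *: f) x0) z := sqrtr_ge0 _.
  have Dle z : defect (rank_one (c%:C *: f) x0) z <= N z + e * nrm z.
    have e0' := ltW e0.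
    rewrite -ler_sqr ?nnegrE ?addr_ge0 ?mulr_ge0 ?nrm_ge0// Dsq sqrrD -addrA lerD2l.
    rewrite (le_trans (_ : _ <= (e * nrm z) ^+ 2)) ?lerDr ?mulrn_wge0 ?mulr_ge0 ?nrm_ge0//.
    by rewrite ler_sqr ?nnegrE ?mulr_ge0 ?nrm_ge0// ler_wpM2l.
  have NleD : N (x + y) <= defect (rank_one (c%:C *: f) x0) (x + y).
    by rewrite -ler_sqr ?nnegrE// Dsq lerDl sqr_ge0.
  apply: (le_trans NleD); apply: (le_trans (Dtri _ _)).
  apply: (le_trans (lerD (Dle x) (Dle y))).
  have : e * (nrm x + nrm y) <= d by apply: le_trans eM; rewrite ler_pM2l// lerDl.
  lra.
have Nx0 a : N (a *: x0) = 0.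
  rewrite /N; have -> : f (a *: x0) = a by rewrite linearZ /= fx0 [LHS]mulr1.
  by rewrite nrmZ n0 mulr1 subrr sqrtr0.
have Nk : N (k + b *: x0) = nrm k.
  have Nkk : N k = nrm k.
    by rewrite /N fk nrm0 expr0n subr0 sqrtr_sqr ger0_norm ?nrm_ge0.
  apply/eqP; rewrite eq_le -Nkk; apply/andP; split.
    by rewrite -[leRHS]addr0 -(Nx0 b) Ntri.
  by have := Ntri (k + b *: x0) (- b *: x0); rewrite Nx0 addr0 scaleNr addrK.
have fkb : f (k + b *: x0) = b by rewrite linearD linearZ /= fk fx0 add0r [LHS]mulr1.
have := Nsq (k + b *: x0); rewrite Nk fkb => ->.
by rewrite subrK.
Qed.

(** For [f] norming [x] and [x0] the direction of [x], write y = k + f(y) x0 with [k] in the kernel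
    of [f]. The orthogonality formula reduces the law to that of the modulus for the numbers |x| and
    f(y). *)
Lemma rank_one_defect_parallelogram : parallelogram X.
Proof.
move=> x y; have [->|xn0] := eqVneq x 0.
  by rewrite add0r sub0r nrmN nrm0; ring.
have nx0 : 0 < nrm x.
  by rewrite lt0r nrm_ge0 andbT; apply: contra xn0 => /eqP/nrm0_eq0 ->.
have [f [f1 fx]] := norming_functional x.
pose x0 := (nrm x)^-1%:C *: x.
have n0 : nrm x0 = 1 by rewrite nrmZr gtr0_norm ?invr_gt0// mulVf// gt_eqF.
have fx0 : f x0 = 1.
  rewrite linearZ /= fx -[LHS]/((nrm x)^-1%:C * (nrm x)%:C) -rmorphM mulVf ?gt_eqF//.
have xE : x = (nrm x)%:C *: x0.
  by rewrite scalerA -rmorphM divff ?gt_eqF// scale1r.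
pose k := y - f y *: x0.
have fk : f k = 0.
  by rewrite linearB linearZ /= fx0 -[X in _ - X]/(f y * 1) mulr1 subrr.
have yE : y = k + f y *: x0 by rewrite subrK.
have O k' b := @rank_one_defect_orthogonal f x0 k' b f1 n0 fx0.
have fNk : f (- k) = 0 by rewrite linearN /= fk oppr0.
have -> : x + y = k + ((nrm x)%:C + f y) *: x0 by rewrite {1}xE {1}yE scalerDl addrCA.
have -> : x - y = - k + ((nrm x)%:C - f y) *: x0.
  by rewrite {1}xE {1}yE scalerBl opprD addrCA.
have -> : nrm y ^+ 2 = nrm (k + f y *: x0) ^+ 2 by rewrite -yE.
rewrite !O// nrmN !sqr_normc; case: (f y) => s t /=; ring.
Qed.

End rank_one.

(** * Ficken's criterion *)

Section ficken.
Context {R : realType}.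

Section plane.
(* n plays the role of the norm of a x + b y in coordinates. *)
Variable n : R -> R -> R.
Hypothesis nZ : forall t a b, n (t * a) (t * b) = `|t| * n a b.
Hypothesis n_ge0 : forall a b, 0 <= n a b.
Hypothesis n_eq0 : forall a b, n a b = 0 -> a = 0 /\ b = 0.
Hypothesis n10 : n 1 0 = 1.

(** A real matrix of determinant -1 and trace t has real eigenvalues l > 0 and -1/l. An isometry has
    only eigenvalues of modulus 1, so l = 1 and t = l - 1/l = 0. *)
Lemma plane_isometry_trace (a b c d : R) : a * d - b * c = -1 ->
  (forall u v, n (a * u + b * v) (c * u + d * v) = n u v) -> a + d = 0.
Proof.
move=> det iso; set t := a + d.
pose l := (t + Num.sqrt (t ^+ 2 + 4)) / 2.
have s2 : Num.sqrt (t ^+ 2 + 4) ^+ 2 = t ^+ 2 + 4 by rewrite sqr_sqrtr// addr_ge0 ?sqr_ge0.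
have lE : l ^+ 2 = t * l + 1 by rewrite /l; move: s2; set s := Num.sqrt _ => s2; nra.
have l0 : 0 < l.
  have : `|t| < Num.sqrt (t ^+ 2 + 4).
    by rewrite -sqrtr_sqr ltr_sqrt ?ltrDl// ltr_wpDl ?sqr_ge0.
  by have := ler_norm (- t); rewrite normrN /l; lra.
have ln0 : l != 0 by rewrite gt_eqF.
pose m := l^-1.
have tE : t = l - m.
  by apply: (mulfI ln0); rewrite mulrBr divff// -expr2 lE; ring.
suff l1 : l = 1 by rewrite tE /m l1 invr1 subrr.
(* By Cayley-Hamilton, (a + m, c), the image of (1, 0) under the matrix plus m I, is an eigenvector
   for [l], unless it vanishes; then (1, 0) is an eigenvector for [- m]. *)
have eig : n (l * (a + m)) (l * c) = n (a + m) c.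
  rewrite -(iso (a + m) c); congr n.
    have -> : b * c = a * d + 1 by move: det; lra.
    have -> : d = l - m - a by rewrite -tE /t; ring.
    by rewrite /m; field.
  have -> : l = t + m by rewrite tE subrK.
  by rewrite /t; ring.
rewrite nZ gtr0_norm// in eig.
have [h|h] := eqVneq (n (a + m) c) 0.
  have [/eqP am c0] := n_eq0 h; rewrite addr_eq0 in am; move/eqP: am => am.
  have := iso 1 0; rewrite !mulr1 !mulr0 !addr0 c0 am n10.
  rewrite -[- m]mulr1 -[X in n _ X](mulr0 (- m)) nZ n10 normrN mulr1.
  rewrite gtr0_norm ?invr_gt0// => /(congr1 (@GRing.inv _)).
  by rewrite invrK invr1.
by apply: (mulIf h); rewrite mul1r.
Qed.

Hypothesis n_swap : forall a b c d, n a b = 1 -> n c d = 1 ->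
  forall s t, n (s * a + t * c) (s * b + t * d) = n (t * a + s * c) (t * b + s * d).
Hypothesis n01 : n 0 1 = 1.

(* The linear maps exchanging two unit vectors are isometries. Those exchanging
   x with z = (x + y) / |x + y|, x with y, and x with w = a x + b y compose to an
   isometry of determinant -1, whose trace is a multiple of
   a^2 + b^2 + (n(1,1)^2 - 2) a b - 1. *)
Lemma plane_norm a b : n a b ^+ 2 = a ^+ 2 + b ^+ 2 + (n 1 1 ^+ 2 - 2) * a * b.
Proof.
have unit u v : n u v = 1 -> v != 0 ->
    u ^+ 2 + v ^+ 2 + (n 1 1 ^+ 2 - 2) * u * v = 1.
  move=> nuv v0.
  (* The matrix with rows (p, (1 - p^2)/q) and (q, -p) exchanges (1, 0) and (p, q). *)
  have swap_x p q : q != 0 -> n p q = 1 -> forall s t,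
      n (p * s + (1 - p ^+ 2) / q * t) (q * s - p * t) = n s t.
    move=> q0 npq s t.
    have := n_swap n10 npq (s - t * p / q) (t / q).
    rewrite !mulr0 !add0r !mulr1.
    have -> : s - t * p / q + t / q * p = s by field.
    have -> : t / q * q = t by field.
    move=> ->; congr n; field; exact: q0.
  have swap s t : n t s = n s t.
    have := n_swap n10 n01 s t; rewrite !mulr0 !mulr1 !add0r !addr0.
    by move=> ->.
  have N0 : n 1 1 != 0 by apply/eqP => /n_eq0[/eqP]; rewrite oner_eq0.
  pose k := (n 1 1)^-1.
  have k0 : k != 0 by rewrite invr_eq0.
  have nk : n k k = 1.
    by rewrite -[k]mulr1 nZ ger0_norm ?invr_ge0// mulVf.
  (* The left side is the trace of the composite of the three exchanges; multiplied by v / k it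
     becomes the required identity. *)
  have H : k * v + (1 - k ^+ 2) / k * u + (- k * u - k * ((1 - u ^+ 2) / v)) = 0.
    apply: (@plane_isometry_trace _
      (- k * u + (1 - k ^+ 2) / k * ((1 - u ^+ 2) / v)) (k * v - k * u)) => [|s t].
      by field; rewrite v0.
    rewrite -[RHS](swap_x u v v0 nuv s t) -[RHS]swap -[RHS](swap_x k k k0 nk).
    by congr n; ring.
  have -> : n 1 1 ^+ 2 = (k ^+ 2)^-1 by rewrite exprVn invrK.
  move: H => /(congr1 (fun z => z * v / k)); rewrite mul0r.
  have -> : (k * v + (1 - k ^+ 2) / k * u + (- k * u - k * ((1 - u ^+ 2) / v))) * v / k
    = u ^+ 2 + v ^+ 2 + ((k ^+ 2)^-1 - 2) * u * v - 1.
    by field; rewrite v0 k0.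
  by rewrite mul0r => /eqP; rewrite subr_eq0 => /eqP.
have [->|b0] := eqVneq b 0.
  rewrite -[in n a 0](mulr1 a) -[X in n _ X](mulr0 a) nZ n10 mulr1 real_normK ?num_real//.
  by ring.
have nab : n a b != 0 by apply/eqP => /n_eq0[_ /eqP]; exact/negP.
have := unit ((n a b)^-1 * a) ((n a b)^-1 * b).
rewrite nZ ger0_norm ?invr_ge0// mulVf// mulf_neq0 ?invr_eq0// => /(_ erefl isT) H.
have -> : a ^+ 2 + b ^+ 2 + (n 1 1 ^+ 2 - 2) * a * b =
   n a b ^+ 2 * (((n a b)^-1 * a) ^+ 2 + ((n a b)^-1 * b) ^+ 2 +
      (n 1 1 ^+ 2 - 2) * ((n a b)^-1 * a) * ((n a b)^-1 * b)).
  by field.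
by rewrite H mulr1.
Qed.

End plane.

Context {X : normedModType R[i]}.

Hypothesis unit_swap : forall (x y : X) t, nrm x = 1 -> nrm y = 1 -> 0 < t < 1 ->
  nrm (x - t%:C *: y) <= nrm (y - t%:C *: x).

(** Dividing by the coefficient of larger modulus leaves some [r] with [|r| <= 1]. For
    [0 < |r| < 1], [unit_swap] in both directions gives the equality, with [- y] in place of [y]
    when [r] is positive. *)
Lemma unit_exchange (u v : X) s t : nrm u = 1 -> nrm v = 1 ->
  nrm (s%:C *: u + t%:C *: v) = nrm (t%:C *: u + s%:C *: v).
Proof.
have pos (x y : X) (r : R) : nrm x = 1 -> nrm y = 1 -> 0 < r < 1 ->
    nrm (x - r%:C *: y) = nrm (y - r%:C *: x).
  by move=> x1 y1 r01; apply/eqP; rewrite eq_le !unit_swap.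
have le1 (x y : X) (r : R) : nrm x = 1 -> nrm y = 1 -> `|r| <= 1 ->
    nrm (x + r%:C *: y) = nrm (y + r%:C *: x).
  move=> x1 y1; rewrite le_eqVlt => /orP[/eqP|] r1.
    have [r0|r0] := lerP 0 r.
      by move: r1; rewrite ger0_norm// => ->; rewrite !scale1r addrC.
    move: r1; rewrite ltr0_norm// => /(congr1 -%R); rewrite opprK => ->.
    by rewrite rmorphN !scaleN1r nrmB.
  have [r0|r0|<-] := ltgtP 0 r; last by rewrite !scale0r !addr0 x1.
    have := pos x (- y) r x1; rewrite nrmN scalerN opprK => ->//.
      by rewrite -opprD nrmN.
    by rewrite r0; move: r1; rewrite gtr0_norm.
  have := pos x y (- r) x1 y1; rewrite rmorphN !scaleNr !opprK => ->//.
  by rewrite oppr_gt0 r0; move: r1; rewrite ltr0_norm.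
wlog st : s t / `|t| <= `|s|.
  move=> H u1 v1; have [ts|/ltW st] := lerP `|t| `|s|; first exact: H.
  by symmetry; exact: H.
move=> u1 v1; have [s0|s0] := eqVneq s 0.
  by move: st; rewrite s0 normr0 normr_le0 => /eqP ->; rewrite !scale0r !addr0.
have tE : t = s * (t / s) by rewrite mulrC divfK.
rewrite tE rmorphM -!scalerA -!scalerDr !nrmZr [_ *: u + v]addrC le1//.
by rewrite normrM normfV ler_pdivrMr ?normr_gt0// mul1r.
Qed.

(** In the real plane of the directions of [x] and [y], [plane_norm] makes the squared norm a
    quadratic form in the coordinates, whose mixed term changes sign with [y]. Dependent directions
    reduce to the line. *)
Lemma ficken : parallelogram X.
Proof.
have unitE (x : X) : x = 0 \/ exists2 u, nrm u = 1 & x = (nrm x)%:C *: u.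
  have [->|x0] := eqVneq x 0; [by left|right].
  have nx0 : nrm x != 0 by apply: contra x0 => /eqP/nrm0_eq0 ->.
  exists ((nrm x)^-1%:C *: x); last by rewrite scalerA -rmorphM divff// scale1r.
  by rewrite nrmZr ger0_norm ?invr_ge0 ?nrm_ge0// mulVf.
move=> x y; have [->|[u u1 xE]] := unitE x.
  by rewrite add0r sub0r nrmN nrm0; ring.
have [->|[v v1 yE]] := unitE y.
  by rewrite addr0 subr0 nrm0; ring.
set a := nrm x in xE *; set b := nrm y in yE *.
have [[c vE]|indep] := pselect (exists c : R, v = c%:C *: u).
  have c1 : c ^+ 2 = 1.
    by rewrite -(expr1n _ 2) -[in RHS]v1 vE nrmZr u1 mulr1 real_normK ?num_real.
  rewrite xE yE vE scalerA -rmorphM -scalerDl -scalerBl -rmorphD -rmorphB !nrmZr u1 !mulr1.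
  rewrite !real_normK ?num_real//.
  have -> : b ^+ 2 = b ^+ 2 * c ^+ 2 by rewrite c1 mulr1.
  by ring.
pose n s t := nrm (s%:C *: u + t%:C *: v).
have nP s t : n s t ^+ 2 = s ^+ 2 + t ^+ 2 + (n 1 1 ^+ 2 - 2) * s * t.
  apply: plane_norm => [r p q|p q|p q||p q p' q' npq npq' r r'|].
  - by rewrite /n !rmorphM -!scalerA -scalerDr nrmZr.
  - exact: nrm_ge0.
  - move=> /nrm0_eq0 pq0.
    have q0 : q = 0.
      apply: contra_notP indep => /eqP q0; exists (- (q^-1 * p)).
      move: pq0 => /(congr1 (fun z => (q^-1)%:C *: z)); rewrite scaler0 scalerDr !scalerA.
      rewrite -!rmorphM mulVf// scale1r => /eqP; rewrite addrC addr_eq0 => /eqP ->.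
      by rewrite rmorphN scaleNr.
    move: pq0; rewrite q0 scale0r addr0 => /(congr1 (@nrm _ _)).
    by rewrite nrmZr u1 mulr1 nrm0 => /normr0_eq0.
  - by rewrite /n scale1r scale0r addr0.
  - have E z z' : (r * z + r' * z')%:C = r%:C * z%:C + r'%:C * z'%:C.
      by rewrite rmorphD !rmorphM.
    have F z z' : (r' * z + r * z')%:C = r'%:C * z%:C + r%:C * z'%:C.
      by rewrite rmorphD !rmorphM.
    have := @unit_exchange (p%:C *: u + q%:C *: v) (p'%:C *: u + q'%:C *: v) r r' npq npq'.
    by rewrite /n !E !F !scalerDl !scalerDr !scalerA addrACA => ->; rewrite addrACA.
  - by rewrite /n scale1r scale0r add0r.
rewrite {1}xE {1}yE -/(n a b).
have -> : x - y = a%:C *: u + (- b)%:C *: v by rewrite rmorphN scaleNr -xE -yE.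
by rewrite -/(n a (- b)) (nP a b) (nP a (- b)); ring.
Qed.

End ficken.

(** * From each condition to the parallelogram law *)

Lemma backward_shift_defect_is_norm {R : realType} {X : completeNormedModType R[i]}
    (T : bop X X) (W : {linear X -> ell2 nat X}) :
  strictly_contractive T -> linear_isometry W ->
  (forall x, backward_shift (W x) = W (T x)) -> is_norm (defect T).
Proof.
move=> /strictly_contractiveE T1 Wiso WT.
have Wn x : nrm (W x) = nrm x by rewrite /nrm Wiso.
(* Dropping coordinate 0 from W x leaves W (T x), so the norm of this coordinate is the defect. *)
pose g x := W x 0%N.
have gl : linear g by move=> a x y; rewrite /g linearP.
pose G : {linear X -> X} := HB.pack g (GRing.isLinear.Build _ _ _ _ g gl).
apply: (@defect_is_norm _ _ _ _ G) => // x.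
by have := sqr_nrm_backward_shift (W x); rewrite WT !Wn => ->; rewrite addrK.
Qed.

Section criteria.
Context {R : realType} {X : completeNormedModType R[i]}.

Lemma defect_parallelogram :
  (forall T : bop X X, strictly_contractive T -> is_norm (defect T)) -> parallelogram X.
Proof.
move=> H; apply: rank_one_defect_parallelogram => f y fy; apply: H.
by apply/strictly_contractiveE; exact: le_lt_trans (opnorm_rank_one f y) fy.
Qed.

Lemma parallelogram_defect : parallelogram X ->
  forall T : bop X X, strictly_contractive T -> is_norm (defect T).
Proof.
move=> PL T /strictly_contractiveE T1; have [J JP] := defect_root PL T1.
exact: (@defect_is_norm _ _ _ T J).
Qed.

(** Evaluating [blaschke a T] at (I - a^* T) y removes the inverse. *)
Lemma blaschke_le (a : R[i]) (T : bop X X) y : `|a| < 1 -> contractive T ->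
  contractive (blaschke a T) -> nrm (T y - a *: y) <= nrm (y - a^* *: T y).
Proof.
move=> a1 T1 /contractiveP/(_ (y - a^* *: T y)).
have [_ /(congr1 (fun f : bop X X => f y)) /= E] := one_sub_scale_invertible a1 T1.
by rewrite /= E.
Qed.

Lemma conjC_realC (t : R) : (t%:C : R[i])^* = t%:C.
Proof. exact: conjc_real. Qed.

Lemma normC_lt1 (t : R) : 0 < t < 1 -> `|t%:C : R[i]| < 1.
Proof. by move=> /andP[t0 t1]; rewrite gtr0_norm ?ltcR// ltcR. Qed.

(** For [f] norming [y], the strict contraction (1 - d) f(.) z sends [y] to (1 - d) z. Applied to it
    at [y], [blaschke_le] is the inequality of [ficken] up to an error 2 d. *)
Lemma automorphism_parallelogram :
  (forall T : bop X X, strictly_contractive T ->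
     forall (theta : R) (a : R[i]), 0 <= theta < pi *+ 2 -> `|a| < 1 ->
       contractive (disk_automorphism theta a T)) -> parallelogram X.
Proof.
move=> H; apply: ficken => z y t z1 y1 t01.
have [f [f1 fy]] := norming_functional y; rewrite y1 in fy.
apply/ler_addgt0Pl => e e0.
pose d := Num.min (e / 2) 2^-1.
have d0 : 0 < d by rewrite lt_min divr_gt0//=.
have de : d <= e / 2 by rewrite ge_min lexx.
have d1 : d < 1 by rewrite gt_min orbC invf_lt1// ltr1n.
pose T := rank_one f ((1 - d)%:C *: z).
have T1 : strictly_contractive T.
  apply/strictly_contractiveE; apply: le_lt_trans (opnorm_rank_one _ _) _.
  rewrite nrmZr z1 mulr1 ger0_norm ?subr_ge0 ?(ltW d1)//.
  apply: (@le_lt_trans _ _ (1 - d)); first by rewrite ler_piMl// subr_ge0 ltW.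
  by rewrite gtrBl.
have Tc : contractive T by exact: ltW.
have Ty : T y = (1 - d)%:C *: z by rewrite /= fy scale1r.
have := H T T1 0 t%:C; rewrite lexx pmulrn_lgt0// pi_gt0 => /(_ isT (normC_lt1 t01)).
have -> : disk_automorphism 0 t%:C T = blaschke t%:C T.
  by rewrite /disk_automorphism cos0 sin0 scale1r.
move=> /(blaschke_le y (normC_lt1 t01) Tc); rewrite Ty conjC_realC.
have zd : z = (1 - d)%:C *: z + d%:C *: z by rewrite -scaleRD subrK scale1r.
have h1 : nrm (z - t%:C *: y) <= nrm ((1 - d)%:C *: z - t%:C *: y) + d.
  rewrite {1}zd addrAC (le_trans (nrmD _ _))// lerD2l.
  by rewrite nrmZr z1 mulr1 gtr0_norm.
have h2 : nrm (y - t%:C *: ((1 - d)%:C *: z)) <= nrm (y - t%:C *: z) + d.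
  rewrite (_ : y - _ = y - t%:C *: z + (t * d)%:C *: z); last first.
    by rewrite {2}zd scalerDr rmorphM -scalerA opprD addrA subrK.
  rewrite (le_trans (nrmD _ _))// lerD2l nrmZr z1 mulr1.
  by case/andP: t01 => t0 t1; rewrite gtr0_norm ?mulr_gt0// ler_piMl// ltW.
by lra.
Qed.

Lemma bilateral_shift_contractive : contractive (@bilateral_shift R X).
Proof.
apply/contractiveP => y.
have hg : ocancel (fun n : int => Some (n - 1)) (fun n => n + 1).
  by move=> n /=; rewrite subrK.
exact: (l2norm_reindex hg (ell2P y)).2.
Qed.

End criteria.

Section shift_and_dual.
Context {R : realType} {X : completeNormedModType R[i]}.

(** Let [u] have entries x, y at the places 0, 1. On the places 0, 1, 2, U u - t u is (- t x, x - t
    y, y) and u - t U u is (x, y - t x, - t y). The outer entries contribute 1 + t^2 to both squared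
    norms, so the middle ones can be compared. *)
Lemma bilateral_shift_parallelogram :
  (forall a : R[i], `|a| < 1 ->
     contractive (blaschke a (bilateral_shift : bop (ell2 int X) (ell2 int X)))) ->
  parallelogram X.
Proof.
move=> H; apply: ficken => x y t x1 y1 t01.
pose w (n : int) : X := if n == 0 then x else if n == 1 then y else 0.
have wss : w \in square_summable.
  apply: (@finite_support_ell2 _ _ _ [:: 0; 1] _ _ _).1 => // n.
  by rewrite !inE negb_or /w => /andP[/negbTE -> /negbTE ->].
pose u := Ell2 wss.
have := blaschke_le u (normC_lt1 t01) bilateral_shift_contractive (H _ (normC_lt1 t01)).
rewrite conjC_realC -ler_sqr ?nnegrE ?nrm_ge0//.
have sup3 (v : ell2 int X) : (forall n, n \notin [:: 0; 1; 2%:Z] -> v n = 0) ->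
    nrm v ^+ 2 = nrm (v 0) ^+ 2 + nrm (v 1) ^+ 2 + nrm (v 2) ^+ 2.
  move=> v0; rewrite nrm_ell2 (@finite_support_ell2 _ _ _ [:: 0; 1; 2%:Z] _ _ v0).2//.
  by rewrite !big_cons big_nil addr0 addrA.
have wn n : n \notin [:: 0; 1; 2%:Z] -> w n = 0 /\ w (n - 1) = 0.
  rewrite !inE !negb_or /w => /and3P[/negbTE -> n1 n2].
  by rewrite (negbTE n1) subr_eq0 (negbTE n1) subr_eq (negbTE n2).
rewrite !sup3.
- rewrite !ell2BE !ell2ZE /= /w /= !scaler0 !subr0 !sub0r !nrmN !nrmZr x1 y1 => h.
  by rewrite -ler_sqr ?nnegrE ?nrm_ge0//; lra.
- by move=> n /wn[wn0 wn1]; rewrite ell2BE ell2ZE /= wn0 wn1 scaler0 subr0.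
- by move=> n /wn[wn0 wn1]; rewrite ell2BE ell2ZE /= wn0 wn1 scaler0 subr0.
Qed.

(** The law passes from the dual to the bidual, into which [X] embeds isometrically thanks to
    norming functionals. *)
Lemma bidual_parallelogram : parallelogram (banach_dual X) -> parallelogram X.
Proof.
move=> PD x y.
have embedE (z : X) : nrm (bidual_embed z) = nrm z.
  apply/eqP; rewrite eq_le; apply/andP; split.
    apply: opnorm_le => [|f]; first exact: nrm_ge0.
    by rewrite mulrC; exact: (opnormP f z).
  have [f [f1 fz]] := norming_functional z.
  have := opnormP (bidual_embed z) f.
  rewrite -[X in X <= _]/(nrm (f z)) fz -[nrm _%:C]/(complex.Re `|_|) Re_normC.
  rewrite ger0_norm ?nrm_ge0// => /le_trans; apply.
  by rewrite ler_piMr ?opnorm_ge0.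
have := dual_parallelogram PD (bidual_embed x) (bidual_embed y).
have -> : bidual_embed x + bidual_embed y = bidual_embed (x + y).
  by apply: bopext => f; rewrite /= linearD.
have -> : bidual_embed x - bidual_embed y = bidual_embed (x - y).
  by apply: bopext => f; rewrite /= linearB.
by rewrite !embedE.
Qed.

(** By reflexivity [Phi] is evaluation at some [x], so the rank one operator Phi(.) g on the dual is
    the adjoint of g(.) x. The latter is a strict contraction since |x| <= |Phi|. *)
Lemma adjoint_dilation_parallelogram : reflexive_space X ->
  (forall T : bop X X, strictly_contractive T ->
     isometric_dilation (adjoint T)
      (unilateral_shift : {linear ell2 nat (banach_dual X) -> ell2 nat (banach_dual X)})) ->
  parallelogram X.
Proof.
move=> refl H; apply: bidual_parallelogram.
apply: rank_one_defect_parallelogram => Phi g Pg.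
have [x xP] := refl Phi.
have E : rank_one Phi g = adjoint (rank_one g x).
  by apply: bopext => f; apply: bopext => y; rewrite /= -xP /= linearZ /= [RHS]mulrC.
have xPhi : nrm x <= opnorm Phi.
  have [f [f1 fx]] := norming_functional x.
  have := opnormP Phi f; rewrite -xP -[X in X <= _]/(nrm (f x)) fx.
  rewrite -[nrm _%:C]/(complex.Re `|_|) Re_normC ger0_norm ?nrm_ge0// => /le_trans; apply.
  by rewrite ler_piMr ?opnorm_ge0.
have T1 : strictly_contractive (rank_one g x).
  apply/strictly_contractiveE; apply: le_lt_trans (opnorm_rank_one _ _) _.
  by apply: le_lt_trans Pg; rewrite mulrC ler_wpM2r ?opnorm_ge0.
have S1 : strictly_contractive (rank_one Phi g).
  by apply/strictly_contractiveE; apply: le_lt_trans (opnorm_rank_one _ _) Pg.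
by rewrite E in S1 *; exact: dilation_defect_is_norm S1 (H _ T1).
Qed.

End shift_and_dual.

(** * The cycle of implications *)

Unset Implicit Arguments.

Theorem theorem1p3 (R : realType) (X : completeNormedModType R[i]) :
  [<-> forall T : bop X X, strictly_contractive T ->
         isometric_dilation T (unilateral_shift : {linear ell2 nat X -> ell2 nat X});
       forall T : bop X X, strictly_contractive T ->
         exists (Xt : completeNormedModType R[i]) (V : {linear Xt -> Xt}),
           isometric_dilation T V;
       forall T : bop X X, strictly_contractive T -> is_norm (defect T);
       is_hilbert X;
       forall T : bop X X, strictly_contractive T ->
         exists W : {linear X -> ell2 nat X},
           linear_isometry W /\ forall x, backward_shift (W x) = W (T x);
       forall T : bop X X, strictly_contractive T ->
         forall (theta : R) (a : R[i]), 0 <= theta < pi *+ 2 -> `|a| < 1 ->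
           contractive (disk_automorphism theta a T);
       forall S : bop (banach_dual X) (banach_dual X),
         strictly_contractive S -> is_norm (defect S);
       reflexive_space X /\
       forall T : bop X X, strictly_contractive T ->
         isometric_dilation (adjoint T)
           (unilateral_shift : {linear ell2 nat (banach_dual X) -> ell2 nat (banach_dual X)});
       forall a : R[i], `|a| < 1 ->
         contractive (blaschke a (bilateral_shift : bop (ell2 int X) (ell2 int X)))].
Proof.
(* From the third condition on, each one yields the parallelogram law for [X], from which the next
   one follows, and from the last one the first. *)
tfae.
- by move=> H T T1; exists (ell2 nat X), unilateral_shift; exact: H.
- by move=> H T T1; have [Xt [V TV]] := H T T1; exact: dilation_defect_is_norm TV.
- by move=> /defect_parallelogram; exact: (is_hilbertP).2.
- move=> /is_hilbertP PL T /strictly_contractiveE T1.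
  have [W [Wiso WT]] := backward_shift_iso PL T1.
  by exists (W : {linear X -> ell2 nat X}); split=> // x; rewrite -!nrmE Wiso.
- move=> H T T1 theta a _ a1.
  have PL : parallelogram X.
    apply: defect_parallelogram => S S1; have [W [Wiso WS]] := H S S1.
    exact: backward_shift_defect_is_norm WS.
  rewrite /contractive /disk_automorphism normrZ.
  have -> : `|cos theta +i* sin theta| = 1 :> R[i].
    by rewrite normc_def /= cos2Dsin2 sqrtr1.
  by rewrite mul1r; apply: hilbert_blaschke => //; exact: ltW.
- move=> /automorphism_parallelogram PL; apply: parallelogram_defect.
  exact: dual_parallelogram.
- move=> /defect_parallelogram PD; have PL := bidual_parallelogram PD.
  split=> [|T T1]; first exact: hilbert_reflexive.
  apply: hilbert_dilation => //; apply/strictly_contractiveE.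
  apply: le_lt_trans (_ : opnorm T < 1); last exact/strictly_contractiveE.
  apply: opnorm_le => [|f]; first exact: opnorm_ge0.
  by rewrite mulrC; exact: opnorm_comp.
- move=> [refl H] a a1; apply: hilbert_blaschke => //.
    by apply: ell2_parallelogram; exact: adjoint_dilation_parallelogram refl H.
  exact: bilateral_shift_contractive.
- by move=> /bilateral_shift_parallelogram PL T; exact: hilbert_dilation.
Qed.
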